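(* For every Polish group $G$, the three statements $\mathrm{TVC}_{I}(G)$, $\mathrm{TVC}_{II}(G)$ and $\mathrm{TVC}_{III}(G)$ are equivalent.
   Context: A Polish space (group) is a separable, completely metrizable topological space (group). A standard Borel space is a Polish space with its associated Borel structure. For a Polish group $G$, a Borel $G$-space is a standard Borel space $X$ with an action $G\times X\to X$ of $G$ that is a Borel map; a Polish $G$-space is a Polish space $X$ with an action $G\times X\to X$ that is continuous. A perfect set is a nonempty closed set without isolated points. ''Countably many'' includes finitely many. For a fixed Polish group $G$ define the following statements (versions of the Topological Vaught Conjecture for $G$). $\mathrm{TVC}_{I}(G)$: for any Polish $G$-space $X$ and any invariant Borel set $B\subseteq X$, either $B$ contains countably many orbits or else there is a perfect set $P\subseteq B$ such that any two distinct members of $P$ belong to different orbits. $\mathrm{TVC}_{II}(G)$: the same as $\mathrm{TVC}_{I}(G)$ but only with $B=X$; that is, for any Polish $G$-space $X$, either $X$ contains countably many orbits or else there is a perfect set $P\subseteq X$ such that any two distinct members of $P$ belong to different orbits. $\mathrm{TVC}_{III}(G)$: for any Borel $G$-space $X$, either $X$ contains countably many orbits or else there is an uncountable Borel set $P\subseteq X$ such that any two distinct members of $P$ belong to different orbits. *)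

(* Defs.v *)
From HB Require Import structures.
From mathcomp Require Import all_boot all_order all_algebra.
From mathcomp Require Import all_classical all_reals.
From mathcomp Require Import topology measure.

Set Implicit Arguments.
Unset Strict Implicit.
Unset Printing Implicit Defensive.

Import Order.TTheory GRing.Theory Num.Theory.
Local Open Scope classical_set_scope.
Local Open Scope ring_scope.

(* [metricType] and [completeType] carry a chosen metric or uniformity, while a
   Polish space only has to admit one; [completeType] and [measurableType] are
   moreover pointed, which would exclude the empty space. Hence complete
   metrizability and Borel sets are stated directly on a [topologicalType]. *)

Section PolishSpace.
Variables (R : realType) (X : topologicalType).

(* The axioms of the factory [isMetric]; nonnegativity follows from them. *)
Definition is_metric (d : X -> X -> R) : Prop :=
  [/\ forall x, d x x = 0,
      forall x y, d x y = 0 -> x = y,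
      forall x y, d x y = d y x &
      forall x y z, d x z <= d x y + d y z].

Definition induces_topology (d : X -> X -> R) : Prop :=
  forall (x : X) (A : set X),
    nbhs x A <-> exists2 e : R, 0 < e & [set y | d x y < e] `<=` A.

(* The limit is taken in the topology of [X]; the notion is only used for
   metrics inducing that topology. *)
Definition complete_metric (d : X -> X -> R) : Prop :=
  forall u : nat -> X,
    (forall e : R, 0 < e -> exists N : nat, forall m n : nat,
       (N <= m)%N -> (N <= n)%N -> d (u m) (u n) < e) ->
    exists l : X, u @ \oo --> l.

Definition completely_metrizable : Prop :=
  exists d : X -> X -> R,
    [/\ is_metric d, induces_topology d & complete_metric d].

Definition separable : Prop :=
  exists2 D : set X, countable D & dense D.

Definition polish : Prop := separable /\ completely_metrizable.

End PolishSpace.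

Definition borel (X : topologicalType) : set (set X) := <<s @open X >>.

Definition borel_map (X Y : topologicalType) (f : X -> Y) : Prop :=
  forall B : set Y, borel B -> borel (f @^-1` B).

(* The library only has additive (abelian) topological groups. *)
HB.mixin Record isTopologicalGroup G & Topological G & Group G := {
  mulg_continuous : continuous (fun p : G * G => (p.1 * p.2)%g) ;
  invg_continuous : continuous (fun x : G => (x^-1)%g)
}.

#[short(type="topologicalGroupType")]
HB.structure Definition TopologicalGroup :=
  {G of Topological G & Group G & isTopologicalGroup G}.

Section Actions.
Variables (G : topologicalGroupType) (X : topologicalType).
Implicit Types (act : G -> X -> X) (B P : set X).

Definition is_action act : Prop :=
  (forall x, act 1%g x = x) /\
  (forall g h x, act (g * h)%g x = act g (act h x)).

Definition orbit_of act (x : X) : set X := range (fun g : G => act g x).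

Definition orbits_in act B : set (set X) := orbit_of act @` B.

Definition invariant act B : Prop := forall g x, B x -> B (act g x).

Definition pairwise_inequivalent act P : Prop :=
  forall x y, P x -> P y -> x <> y -> orbit_of act x <> orbit_of act y.

Definition polish_Gspace (R : realType) act : Prop :=
  [/\ polish R X, is_action act &
      continuous (fun p : G * X => act p.1 p.2)].

(* A standard Borel space is given by a Polish topology, of which only the
   Borel sets are used. For Polish [G] and [X], the Borel sets of the product
   topology on [G * X] form the product of the two Borel sigma-algebras. *)
Definition borel_Gspace (R : realType) act : Prop :=
  [/\ polish R X, is_action act &
      borel_map (fun p : G * X => act p.1 p.2)].

End Actions.

(* The library's [perfect_set] allows the empty set. *)
Definition nonempty_perfect (X : topologicalType) (P : set X) : Prop :=
  P !=set0 /\ perfect_set P.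

Definition TVC_I (R : realType) (G : topologicalGroupType) : Prop :=
  forall (X : topologicalType) (act : G -> X -> X),
    polish_Gspace R act ->
  forall B : set X, borel B -> invariant act B ->
    countable (orbits_in act B) \/
    exists P : set X,
      [/\ nonempty_perfect P, P `<=` B & pairwise_inequivalent act P].

Definition TVC_II (R : realType) (G : topologicalGroupType) : Prop :=
  forall (X : topologicalType) (act : G -> X -> X),
    polish_Gspace R act ->
    countable (orbits_in act [set: X]) \/
    exists P : set X, nonempty_perfect P /\ pairwise_inequivalent act P.

Definition TVC_III (R : realType) (G : topologicalGroupType) : Prop :=
  forall (X : topologicalType) (act : G -> X -> X),
    borel_Gspace R act ->
    countable (orbits_in act [set: X]) \/
    exists P : set X,
      [/\ borel P, ~ countable P & pairwise_inequivalent act P].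

(* Main.v *)
Require Import Defs.
From HB Require Import structures.
From mathcomp Require Import all_boot all_order all_algebra.
From mathcomp Require Import all_classical all_reals.
From mathcomp Require Import topology measure cantor.
From mathcomp Require Import lra.

(** The heart of the matter is the Becker-Kechris theorem: every Borel G-space
carries a Polish topology, with Borel open sets, for which the action is
continuous.  Fix a left-invariant metric on G (Birkhoff-Kakutani), and for a
Borel set B and a point x let q_B^x(g) be the distance from g to
{h | h^-1 x not in B}, where meager sets are neglected.  The function q_B^x is
1-Lipschitz and q_B^{hx}(g) = q_B^x(h^-1 g), so for a countable family of sets B
the map x |-> (q_B^x)_B is an equivariant map to a compact space of Lipschitz
functions, on which G acts continuously.  Let the family be a base of a finer
Polish topology T in which all the functions x |-> q_B^x(g), g in a countable
dense set, are continuous.  Then z is in the image if and only if for generic g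
there is B with z_B(g) > 0, of small T-diameter and on which y |-> q_B'^y(g') is
nearly constant, with value close to z_B'(g g'); by the Baire category theorem
this is a G_delta condition, so the image is Polish.

This gives II => III, since a nonempty perfect set of the new topology is closed,
hence Borel, and uncountable.  For III => I, an invariant Borel set B of a Polish
G-space is a Borel G-space, because B becomes clopen in a finer Polish topology
with the same Borel sets; and an uncountable Borel set contains a perfect set. *)

Set Implicit Arguments.
Unset Strict Implicit.
Unset Printing Implicit Defensive.

Import Order.TTheory GRing.Theory Num.Theory.
Local Open Scope classical_set_scope.
Local Open Scope ring_scope.


(** * Pseudometrics *)

(** Since one set is given many topologies, refinements are expressed by pseudometrics on a bare
    type. Two metrics on G are needed: equivariance asks for a left-invariant [l], which may be
    incomplete, so Baire category relies on a complete [d]. The function space is never formed: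
    [emetric] is its metric pulled back to X, a point of the closure of the image is represented by
    a Cauchy sequence, and the G_delta condition becomes a sequence of open covers of X. The
    difficulty is that a limit function z comes without a point. The point is found as [g y0], where
    g is generic and [y0] is the T-limit of points in small sets B with z_B(g) > 0. The topology T
    only serves this recovery; the action need not be continuous for it. Nor need the action stay
    continuous when B is made clopen, which is why III, and not II, is applied to B. *)

Definition eps (R : realType) (n : nat) : R := n.+1%:R^-1.

Section Eps.
Variable R : realType.

Lemma eps_gt0 n : 0 < eps R n.
Proof. by rewrite invr_gt0 ltr0n. Qed.

Lemma eps_lt (e : R) : 0 < e -> exists n, eps R n < e.
Proof.
move=> e0; have [n hn] : exists n : nat, e^-1 < n%:R.
  exists (Num.bound e^-1); apply: le_lt_trans (archi_boundP _); first by [].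
  by rewrite invr_ge0 ltW.
exists n; rewrite /eps -(invrK e) ltf_pV2 ?posrE ?invr_gt0 ?ltr0n //.
by apply: lt_trans hn _; rewrite ltr_nat.
Qed.

Lemma eps_le m n : (m <= n)%N -> eps R n <= eps R m.
Proof. by move=> mn; rewrite lef_pV2 ?posrE ?ltr0n // ler_nat. Qed.

End Eps.

Section Pseudometrics.
Variables (R : realType) (T : Type).
Implicit Types (p q : T -> T -> R) (x y : T) (U : set T).

Definition pmet p :=
  [/\ forall x, p x x = 0, forall x y, p x y = p y x
    & forall x y z, p x z <= p x y + p y z].

Definition separated p := forall x y, p x y = 0 -> x = y.

Definition mball p x (r : R) : set T := [set y | p x y < r].

Definition mopen p U :=
  forall x, U x -> exists2 r, 0 < r & mball p x r `<=` U.

Definition mcauchy p (u : nat -> T) := forall e, 0 < e -> exists N, forall m n,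
  (N <= m)%N -> (N <= n)%N -> p (u m) (u n) < e.

Definition mlim p (u : nat -> T) l := forall e, 0 < e -> exists N, forall n,
  (N <= n)%N -> p (u n) l < e.

Definition mcomplete p := forall u, mcauchy p u -> exists l, mlim p u l.

(* Equivalent to the existence of a countable dense set, but it is visibly
   inherited by subspaces and does not mention points of a possibly empty [T]. *)
Definition msep p := forall e, 0 < e ->
  exists c : T -> nat, forall x y, c x = c y -> p x y < e.

Definition finer p q := forall x e, 0 < e ->
  exists2 r, 0 < r & mball p x r `<=` mball q x e.

Definition mcontinuous p (f : T -> R) := forall x e, 0 < e ->
  exists2 r, 0 < r & forall y, p x y < r -> `|f x - f y| < e.

Definition polishm p := [/\ pmet p, separated p, mcomplete p & msep p].

Lemma pmet_ge0 p x y : pmet p -> 0 <= p x y.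
Proof. by case=> h1 h2 h3; have := h3 x y x; rewrite h1 (h2 y x); lra. Qed.

Lemma mball_open p x r : pmet p -> mopen p (mball p x r).
Proof.
move=> [h1 h2 h3] y; rewrite /mball /= => xy; exists (r - p x y); first lra.
by move=> z; rewrite /mball /= => yz; have := h3 x y z; lra.
Qed.

Lemma mball_center p x r : pmet p -> 0 < r -> mball p x r x.
Proof. by case=> h1 _ _ r0; rewrite /mball /= h1. Qed.

Lemma mball_le p x r s : r <= s -> mball p x r `<=` mball p x s.
Proof. by move=> rs y h; apply: lt_le_trans h rs. Qed.

Lemma finer_open p q U : finer p q -> mopen q U -> mopen p U.
Proof.
move=> pq oU x Ux; have [r r0 rU] := oU x Ux.
by have [s s0 sr] := pq x r r0; exists s => // y /sr /rU.
Qed.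

Lemma finer_refl p : finer p p.
Proof. by move=> x e e0; exists e. Qed.

Lemma finer_trans p q s : finer p q -> finer q s -> finer p s.
Proof.
move=> pq qs x e e0; have [r r0 rs] := qs x e e0.
by have [t t0 tr] := pq x r r0; exists t => // y /tr /rs.
Qed.

Lemma finer_lim p q u l : pmet p -> pmet q -> finer p q ->
  mlim p u l -> mlim q u l.
Proof.
move=> [_ sp _] [_ sq _] pq ul e e0; have [r r0 rs] := pq l e e0.
have [N hN] := ul r r0; exists N => n /hN.
by rewrite sp sq => /rs.
Qed.

Lemma mopenI p U V : mopen p U -> mopen p V -> mopen p (U `&` V).
Proof.
move=> oU oV x [Ux Vx]; have [r r0 rU] := oU x Ux; have [s s0 sV] := oV x Vx.
exists (Num.min r s); first by rewrite lt_min r0.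
by move=> y; rewrite /mball /= lt_min => /andP[/rU ? /sV].
Qed.

Lemma mopen_bigcup p (F : nat -> set T) :
  (forall n, mopen p (F n)) -> mopen p (\bigcup_n F n).
Proof.
move=> oF x [n _ Fx]; have [r r0 rF] := oF n x Fx.
by exists r => // y /rF ?; exists n.
Qed.

Lemma mlim_unique p u l l' : pmet p -> separated p ->
  mlim p u l -> mlim p u l' -> l = l'.
Proof.
move=> hp sp ul ul'; apply: sp; apply/eqP; rewrite eq_le pmet_ge0 // andbT.
apply/ler_addgt0Pr => e e0; rewrite add0r.
have e2 : 0 < e / 2 by lra.
have [N hN] := ul _ e2; have [M hM] := ul' _ e2.
have h := hN _ (leq_maxl N M); have h' := hM _ (leq_maxr N M).
case: hp => _ s t; have := t l (u (maxn N M)) l'.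
by rewrite (s l (u _)); lra.
Qed.

Lemma mcontinuous_open_gt p f a : mcontinuous p f -> mopen p [set x | a < f x].
Proof.
move=> cf x /= ax; have ax0 : 0 < f x - a by lra.
have [r r0 h] := cf x _ ax0; exists r => // y /h /=.
by rewrite ltr_norml => /andP[]; lra.
Qed.

Lemma mcontinuous_open_lt p f a : mcontinuous p f -> mopen p [set x | f x < a].
Proof.
move=> cf x /= ax; have ax0 : 0 < a - f x by lra.
have [r r0 h] := cf x _ ax0; exists r => // y /h /=.
by rewrite ltr_norml => /andP[]; lra.
Qed.

Lemma open_mcontinuous p f : (forall a, mopen p [set x | a < f x]) ->
  (forall a, mopen p [set x | f x < a]) -> mcontinuous p f.
Proof.
move=> h1 h2 x e e0.
have [r r0 hr] : exists2 r, 0 < r & mball p x r `<=` [set y | f x - e < f y].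
  by apply: h1 => /=; lra.
have [s s0 hs] : exists2 r, 0 < r & mball p x r `<=` [set y | f y < f x + e].
  by apply: h2 => /=; lra.
exists (Num.min r s); first by rewrite lt_min r0.
move=> y; rewrite lt_min => /andP[/hr /= + /hs /=].
by rewrite ltr_norml => *; apply/andP; split; lra.
Qed.

Lemma finer_continuous p q f : finer p q -> mcontinuous q f -> mcontinuous p f.
Proof.
move=> pq cf x e e0; have [r r0 h] := cf x e e0.
by have [s s0 hs] := pq x r r0; exists s => // y /hs /h.
Qed.

(* Balls of radius [eps k] around one representative of each of the countably
   many classes of the separability code. *)
Lemma msep_base p : pmet p -> msep p -> exists B : nat -> set T,
  (forall n, B n = set0 \/ exists x r, B n = mball p x r) /\
  (forall x e, 0 < e -> exists n, B n x /\ B n `<=` mball p x e).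
Proof.
move=> hp sp.
have /choice[c hc] : forall k, exists c : T -> nat,
    forall x y, c x = c y -> p x y < eps R k.
  by move=> k; apply/sp/eps_gt0.
have /choice[rep hrep] : forall ki : nat * nat, exists o : option T,
    if o is Some x then c ki.1 x = ki.2 else forall x, c ki.1 x <> ki.2.
  move=> ki; have [[x hx]|h] := pselect (exists x, c ki.1 x = ki.2).
    by exists (Some x).
  by exists None => x hx; apply: h; exists x.
pose B n := if unpickle n is Some ki then
  (if rep ki is Some x then mball p x (eps R ki.1) else set0) else set0.
exists B; split.
  move=> n; rewrite /B; case: (unpickle n) => [ki|]; last by left.
  by case: (rep ki) => [x|]; [right; exists x, (eps R ki.1)|left].
move=> x e e0; have e2 : 0 < e / 2 by lra.
have [k hk] := eps_lt e2; exists (pickle (k, c k x)).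
rewrite /B pickleK; case: (rep _) (hrep (k, c k x)) => [y /= cy|/(_ x) //].
split; first exact: hc.
move=> z; rewrite /mball /= => yz; case: hp => _ s t.
by have := t x y z; have := hc _ _ _ cy; rewrite (s y); lra.
Qed.

Lemma base_cover p (B : nat -> set T) U :
  (forall x e, 0 < e -> exists n, B n x /\ B n `<=` mball p x e) ->
  mopen p U -> U = \bigcup_n (if `[< B n `<=` U >] then B n else set0).
Proof.
move=> hB oU; apply/seteqP; split=> [x Ux|x [n _]]; last first.
  by case: asboolP => // h /h.
have [r r0 rU] := oU x Ux; have [n [Bx Br]] := hB x r r0.
by exists n => //; rewrite asboolT // => y /Br /rU.
Qed.

End Pseudometrics.

(** * Closure properties of sigma-algebras *)

Section SigmaAlgebra.
Variables (T : Type) (S : set (set T)).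
Hypothesis sS : sigma_algebra setT S.

Lemma sigma0 : S set0. Proof. by case: sS. Qed.

Lemma sigmaC A : S A -> S (~` A).
Proof. by case: sS => _ h _ /h; rewrite setTD. Qed.

Lemma sigmaT : S setT.
Proof. by rewrite -setC0; apply/sigmaC/sigma0. Qed.

Lemma sigma_bigcup (A : nat -> set T) : (forall n, S (A n)) -> S (\bigcup_n A n).
Proof. by case: sS => _ _; apply. Qed.

Lemma sigma_bigcap (A : nat -> set T) : (forall n, S (A n)) -> S (\bigcap_n A n).
Proof.
move=> h; rewrite -[X in S X]setCK setC_bigcap.
by apply/sigmaC/sigma_bigcup => n; apply: sigmaC.
Qed.

Lemma sigma_countable_union (I : countType) (P : I -> Prop) (A : I -> set T) :
  (forall i, S (A i)) -> S [set x | exists i, P i /\ A i x].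
Proof.
move=> h; pose F n := if unpickle n is Some i then
  (if `[< P i >] then A i else set0) else set0.
suff -> : [set x | exists i, P i /\ A i x] = \bigcup_n F n.
  apply: sigma_bigcup => n; rewrite /F; case: (unpickle n) => [i|]; last exact: sigma0.
  by case: ifP => _; [exact: h|exact: sigma0].
apply/seteqP; split=> [x [i [Pi Ai]]|x [n _]].
  by exists (pickle i) => //; rewrite /F pickleK asboolT.
by rewrite /F; case: (unpickle n) => // i; case: asboolP => // Pi Ai; exists i.
Qed.

Lemma sigma_countable_inter (I : countType) (P : I -> Prop) (A : I -> set T) :
  (forall i, S (A i)) -> S [set x | forall i, P i -> A i x].
Proof.
move=> h; suff -> : [set x | forall i, P i -> A i x] =
    ~` [set x | exists i, P i /\ (~` A i) x].
  by apply/sigmaC/sigma_countable_union => i; apply/sigmaC.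
apply/seteqP; split=> [x hx [i [Pi]]|x hx i Pi]; first by apply; apply: hx.
by apply: contrapT => nA; apply: hx; exists i.
Qed.

Lemma sigmaI A B : S A -> S B -> S (A `&` B).
Proof.
move=> SA SB; have -> : A `&` B =
    [set x | forall b : bool, True -> (if b then A else B) x].
  apply/seteqP; split=> [x [? ?] []|x h] //; split.
    exact: (h true).
  exact: (h false).
by apply: sigma_countable_inter; case.
Qed.

Lemma sigmaU A B : S A -> S B -> S (A `|` B).
Proof. by move=> SA SB; rewrite -[_ `|` _]setCK setCU; apply/sigmaC/sigmaI; apply/sigmaC. Qed.

End SigmaAlgebra.

(** * Countable joins of pseudometrics *)

Section Join.
Variables (R : realType) (T : Type) (p : nat -> T -> T -> R).
Hypothesis hp : forall n, pmet (p n).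

(** The caps [eps R n] tend to 0, so below any given bound only finitely many of the pseudometrics
    matter; the supremum therefore induces the join of their topologies. *)
Definition djoin (x y : T) : R := sup (range (fun n => Num.min (eps R n) (p n x y))).

Let ubd x y : has_ubound (range (fun n => Num.min (eps R n) (p n x y))).
Proof.
exists 1 => _ [n _ <-]; rewrite ge_min; apply/orP; left.
by apply: le_trans (eps_le R (leq0n n)) _; rewrite /eps invr1.
Qed.

Lemma djoin_ge x y n : Num.min (eps R n) (p n x y) <= djoin x y.
Proof. by apply: ub_le_sup; [exact: ubd|exists n]. Qed.

Lemma djoin_le x y e : (forall n, Num.min (eps R n) (p n x y) <= e) -> djoin x y <= e.
Proof.
move=> h; apply: ge_sup; first by exists (Num.min (eps R 0) (p 0 x y)); exists 0%N.
by move=> _ [n _ <-].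
Qed.

Lemma djoin_lt x y e n : djoin x y < e -> e <= eps R n -> p n x y < e.
Proof.
move=> h he; have := le_lt_trans (djoin_ge x y n) h.
by rewrite gt_min => /orP[|//]; rewrite ltNge he.
Qed.

Lemma djoin_small e : 0 < e -> exists N, forall x y,
  (forall n, (n < N)%N -> p n x y < e) -> djoin x y <= e.
Proof.
move=> e0; have [N hN] := eps_lt e0; exists N => x y h.
apply: djoin_le => n; rewrite ge_min; have [nN|nN] := ltnP n N.
  by rewrite (ltW (h _ nN)) orbT.
by rewrite (le_trans (eps_le R nN)) // ltW.
Qed.

Lemma djoin_pmet : pmet djoin.
Proof.
have join0 x y : 0 <= djoin x y.
  apply: le_trans (djoin_ge x y 0); rewrite le_min (ltW (eps_gt0 R 0)) /=.
  exact: pmet_ge0.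
split=> [x|x y|x y z].
- apply/eqP; rewrite eq_le join0 andbT; apply: djoin_le => n.
  by case: (hp n) => -> _ _; rewrite ge_min lexx orbT.
- by apply/eqP; rewrite eq_le; apply/andP; split; apply: djoin_le => n;
    case: (hp n) => _ -> _; exact: djoin_ge.
- apply: djoin_le => n; have := djoin_ge x y n; have := djoin_ge y z n.
  have := eps_gt0 R n; have [_ _ /(_ x y z)] := hp n.
  have := pmet_ge0 x y (hp n); have := pmet_ge0 y z (hp n).
  case: (leP (eps R n) (p n x y)); case: (leP (eps R n) (p n y z));
    case: (leP (eps R n) (p n x z)); lra.
Qed.

Lemma djoin_uniform n e : 0 < e -> exists2 r, 0 < r &
  forall x y, djoin x y < r -> p n x y < e.
Proof.
move=> e0; exists (Num.min e (eps R n)); first by rewrite lt_min e0 eps_gt0.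
move=> x y h; apply: lt_le_trans (djoin_lt h _) _; by rewrite ge_min lexx ?orbT.
Qed.

Lemma djoin_finer n : finer djoin (p n).
Proof.
by move=> x e e0; have [r r0 h] := djoin_uniform n e0; exists r => // y /h.
Qed.

Lemma finer_initial q x e N : (forall n, (n < N)%N -> finer q (p n)) -> 0 < e ->
  exists2 r, 0 < r & forall y, q x y < r -> forall n, (n < N)%N -> p n x y < e.
Proof.
move=> + e0; elim: N => [_|M IH h]; first by exists 1.
have [r r0 hr] := IH (fun n nM => h n (ltnW nM)).
have [s s0 hs] := h M (ltnSn M) x _ e0.
exists (Num.min r s); first by rewrite lt_min r0.
move=> y; rewrite lt_min => /andP[/hr hy /hs sy] n.
by rewrite ltnS leq_eqVlt => /predU1P[->|/hy].
Qed.

Lemma finer_djoin q : (forall n, finer q (p n)) -> finer q djoin.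
Proof.
move=> h x e e0; have e2 : 0 < e / 2 by lra.
have [N hN] := djoin_small e2.
have [r r0 hr] := finer_initial x (fun n (_ : (n < N)%N) => h n) e2.
by exists r => // y /hr /hN /=; rewrite /mball /=; lra.
Qed.

Lemma djoin_cauchy u n : mcauchy djoin u -> mcauchy (p n) u.
Proof.
move=> h e e0; have [r r0 hr] := djoin_uniform n e0.
by have [N hN] := h r r0; exists N => i j hi hj; apply/hr/hN.
Qed.

Lemma djoin_lim u l : (forall n, mlim (p n) u l) -> mlim djoin u l.
Proof.
move=> h e e0; have e2 : 0 < e / 2 by lra.
have [M hM] := djoin_small e2; have /choice[N hN] := fun n => h n _ e2.
exists (\max_(n < M) N n) => i hi; apply: (@le_lt_trans _ _ (e / 2)); last by lra.
apply: hM => n nM; apply: hN; apply: leq_trans hi.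
exact: (@leq_bigmax _ (fun n : 'I_M => N n) (Ordinal nM)).
Qed.

Lemma djoin_complete :
  (forall u, (forall n, mcauchy (p n) u) -> exists l, forall n, mlim (p n) u l) ->
  mcomplete djoin.
Proof.
move=> h u cu; have [l hl] := h u (fun n => djoin_cauchy n cu).
by exists l; exact: djoin_lim.
Qed.

Lemma djoin_separated : (forall x y, (forall n, p n x y = 0) -> x = y) ->
  separated djoin.
Proof.
move=> h x y hxy; apply: h => n; apply/eqP; rewrite eq_le pmet_ge0 // andbT.
have := djoin_ge x y n; rewrite hxy ge_min => /orP[|//].
by rewrite leNgt eps_gt0.
Qed.

Lemma djoin_sep : (forall n, msep (p n)) -> msep djoin.
Proof.
move=> h e e0; have e2 : 0 < e / 2 by lra.
have [N hN] := djoin_small e2.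
have /choice[c hc] := fun n => h n _ e2.
exists (fun x => pickle [seq c n x | n <- iota 0 N]) => x y.
move/(pcan_inj pickleK)/eq_in_map => hxy.
apply: (@le_lt_trans _ _ (e / 2)); last by lra.
apply: hN => n nN; apply: hc; apply: hxy.
by rewrite mem_iota.
Qed.

Lemma djoin_meas S : sigma_algebra setT S ->
  (forall n x a, S [set y | p n x y <= a]) -> msep djoin ->
  forall U, mopen djoin U -> S U.
Proof.
move=> sS h sj U oU; have [B [Bb hB]] := msep_base djoin_pmet sj.
rewrite (base_cover hB oU); apply: (sigma_bigcup sS) => n.
case: ifP => _; last exact: sigma0.
case: (Bb n) => [->|[x [r ->]]]; first exact: sigma0.
(* A strict bound on a supremum needs a uniform margin, here [eps R k]. *)
have -> : mball djoin x r = \bigcup_k \bigcap_n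
    [set y | Num.min (eps R n) (p n x y) <= r - eps R k].
  apply/seteqP; split=> [y|y [k _ hk]].
    rewrite /mball /= => xy; have xy0 : 0 < r - djoin x y by lra.
    have [k hk] := eps_lt xy0; exists k => // i _ /=.
    by apply: le_trans (djoin_ge x y i) _; lra.
  apply: (@le_lt_trans _ _ (r - eps R k)); first by apply: djoin_le => i; exact: hk.
  by have := eps_gt0 R k; lra.
apply: (sigma_bigcup sS) => k; apply: (sigma_bigcap sS) => i.
have [hi|hi] := leP (eps R i) (r - eps R k).
  rewrite (_ : [set _ | _] = setT); first exact: sigmaT.
  by apply/seteqP; split=> // y _ /=; rewrite ge_min hi.
rewrite (_ : [set _ | _] = [set y | p i x y <= r - eps R k]); first exact: h.
by apply/seteqP; split=> y /=; rewrite ge_min leNgt hi.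
Qed.

End Join.

Section FunctionPseudometric.
Variables (R : realType) (T : Type).
Implicit Types (f : T -> R) (p : T -> T -> R).

(** Joining this pseudometric to a metric gives the coarsest refinement for which [f] is
    continuous. *)
Definition fdist f (x y : T) : R := `|f x - f y|.

Lemma fdist_pmet f : pmet (fdist f).
Proof.
split=> [x|x y|x y z]; rewrite /fdist; first by rewrite subrr normr0.
  by rewrite distrC.
exact: ler_distD.
Qed.

Lemma fdist_sep f : msep (fdist f).
Proof.
move=> e e0; exists (fun x => pickle (Num.floor (f x / e))) => x y.
move/(pcan_inj pickleK) => hxy; rewrite /fdist.
have := floor_itv (f x / e); have := floor_itv (f y / e); rewrite hxy intrD.
set m := _%:~R => /andP[y1 y2] /andP[x1 x2].
have -> : f x - f y = (f x / e - f y / e) * e by rewrite mulrBl !divfK ?gt_eqF.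
rewrite normrM (gtr0_norm e0) -[ltRHS]mul1r ltr_pM2r // ltr_norml.
by apply/andP; split; lra.
Qed.

Lemma fdist_meas f S : sigma_algebra setT S -> (forall a, S [set x | f x <= a]) ->
  forall x a, S [set y | fdist f x y <= a].
Proof.
move=> sS h x a.
have -> : [set y | fdist f x y <= a] = [set y | f y <= f x + a] `&`
    ~` [set y | exists k : nat, True /\ f y <= f x - a - eps R k].
  apply/seteqP; split=> y; rewrite /fdist /= ler_distl.
    move=> /andP[h1 h2]; split; first by lra.
    by move=> [k [_ /= hk]]; have := eps_gt0 R k; lra.
  move=> [h1 h2]; apply/andP; split; first by lra.
  rewrite leNgt; apply/negP => h3; apply: h2.
  have h4 : 0 < f x - a - f y by lra.
  by have [k hk] := eps_lt h4; exists k; split => //; lra.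
apply: (sigmaI sS); first exact: h.
apply: (sigmaC sS).
by have := sigma_countable_union sS (fun=> True)
  (fun k : nat => h (f x - a - eps R k)).
Qed.

Lemma lipschitz_mcontinuous p f : (forall x y, `|f x - f y| <= p x y) ->
  mcontinuous p f.
Proof. by move=> h x e e0; exists e => // y; apply: le_lt_trans. Qed.

Lemma pmet_meas p S : pmet p -> sigma_algebra setT S ->
  (forall U, mopen p U -> S U) -> forall x a, S [set y | p x y <= a].
Proof.
move=> hp sS h x a; rewrite (_ : [set _ | _] = ~` [set y | a < p x y]).
  apply/(sigmaC sS)/h/mcontinuous_open_gt/lipschitz_mcontinuous => y z.
  case: hp => _ s t; have := t x y z; have := t x z y; rewrite (s z y).
  by rewrite ler_norml => *; apply/andP; split; lra.
by apply/seteqP; split=> y /=; rewrite leNgt => /negP.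
Qed.

End FunctionPseudometric.

(** * Radius functions of hereditary properties of sets *)

Section SupRadius.
Variables (R : realType) (T : Type) (p : T -> T -> R) (P : set T -> Prop).
Hypotheses (hp : pmet p) (P0 : P set0).
Hypothesis PS : forall A B : set T, A `<=` B -> P B -> P A.

(** For hereditary [P] this is 1-Lipschitz, whatever [P] says. It is used with inclusion in an open
    set (capped distance to the complement), inclusion in a member of a cover, and comeagerness. The
    cap at 1 keeps the supremum finite. *)
Definition srad (x : T) : R := sup [set r | 0 <= r <= 1 /\ P (mball p x r)].

Let ubd x : has_ubound [set r | 0 <= r <= 1 /\ P (mball p x r)].
Proof. by exists 1 => r [/andP[]]. Qed.

Let in0 x : [set r | 0 <= r <= 1 /\ P (mball p x r)] 0.
Proof.
split; first by rewrite lexx ler01.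
apply: PS P0 => y; rewrite /mball /= => h.
by have := pmet_ge0 x y hp; rewrite leNgt h.
Qed.

Lemma srad_ge0 x : 0 <= srad x.
Proof. by apply: ub_le_sup; [exact: ubd|exact: in0]. Qed.

Lemma srad_le1 x : srad x <= 1.
Proof. by apply: ge_sup; [exists 0|move=> r [/andP[]]]. Qed.

Lemma srad_ge x r : 0 <= r <= 1 -> P (mball p x r) -> r <= srad x.
Proof. by move=> r01 Pr; apply: ub_le_sup; [exact: ubd|]. Qed.

Lemma srad_gt x r : r < srad x -> exists2 s, r < s & 0 <= s <= 1 /\ P (mball p x s).
Proof.
move=> h; have e0 : 0 < srad x - r by lra.
have [|s hs] := sup_adherent e0 (E := [set r | 0 <= r <= 1 /\ P (mball p x r)]).
  by split; [exists 0|].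
by rewrite opprB addrC subrK; exists s.
Qed.

Lemma srad_ball x r : r < srad x -> P (mball p x r).
Proof.
by move=> /srad_gt[s rs [_]]; apply: PS; apply: mball_le; apply: ltW.
Qed.

Lemma srad_lip x y : `|srad x - srad y| <= p x y.
Proof.
have half a b : srad a <= srad b + p a b.
  have pab := pmet_ge0 a b hp; apply: ge_sup; first by exists 0.
  move=> r [/andP[r0 r1] hr]; have [h|h] := leP r (p a b).
    by have := srad_ge0 b; lra.
  suff : r - p a b <= srad b by lra.
  apply: srad_ge; first by apply/andP; split; lra.
  apply: PS hr => z; rewrite /mball /= => bz.
  by case: hp => _ _ t; have := t a b z; lra.
have := half x y; have := half y x; case: hp => _ -> _.
by rewrite ler_norml => *; apply/andP; split; lra.
Qed.

Lemma srad_continuous : mcontinuous p srad.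
Proof. by apply: lipschitz_mcontinuous; exact: srad_lip. Qed.

End SupRadius.

Section Inverse.
Variables (R : realType) (T : Type) (p : T -> T -> R) (s : T -> R).
Hypotheses (hp : pmet p) (s0 : forall x, 0 <= s x) (cs : mcontinuous p s).

Lemma inv_near (a e : R) : 0 < a -> 0 < e -> exists2 r, 0 < r &
  forall b, `|a - b| < r -> `|a^-1 - b^-1| < e.
Proof.
move=> a0 e0; exists (Num.min (a / 2) (e * (a * a) / 2)).
  by rewrite lt_min !mulr_gt0 ?invr_gt0.
move=> b; rewrite lt_min => /andP[h1 h2].
have b0 : a / 2 < b by move: h1; rewrite ltr_norml => /andP[]; lra.
have b1 : 0 < b by lra.
have -> : a^-1 - b^-1 = (b - a) / (a * b).
  rewrite mulrBl invfM mulrCA divff ?mulr1 ?gt_eqF //.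
  by rewrite mulrA divff ?mul1r ?gt_eqF.
rewrite normrM normfV (gtr0_norm (mulr_gt0 a0 b1)) ltr_pdivrMr ?mulr_gt0 //.
rewrite distrC; apply: lt_le_trans h2 _.
rewrite -mulrA ler_pM2l // -mulrA ler_pM2l //; lra.
Qed.

Lemma inv_lim u l : 0 < s l -> mlim p u l -> mlim (fdist (fun x => (s x)^-1)) u l.
Proof.
move=> sl ul e e0; have [r r0 hr] := inv_near sl e0; have [d d0 hd] := cs l r0.
have [N hN] := ul d d0; exists N => n /hN h.
by rewrite /fdist distrC; apply/hr/hd; case: hp => _ -> _.
Qed.

(** Bounded reciprocals keep [s] away from 0. The exception [s (u n) = 0] is due to the convention
    that the inverse of 0 is 0. *)
Lemma inv_cauchy_bounded u : mcauchy (fdist (fun x => (s x)^-1)) u ->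
  exists2 c, 0 < c & exists N, forall n, (N <= n)%N -> s (u n) = 0 \/ c <= s (u n).
Proof.
move=> /(_ 1 ltr01)[N hN]; pose M := 1 + (s (u N))^-1.
have M0 : 0 < M by rewrite /M ltr_pwDl // invr_ge0.
exists M^-1; first by rewrite invr_gt0.
exists N => n nN; have [sn|sn] := eqVneq (s (u n)) 0; first by left.
have sn0 : 0 < s (u n) by rewrite lt_def sn s0.
right; rewrite -[leRHS]invrK lef_pV2 ?posrE ?invr_gt0 //.
have := hN n N nN (leqnn N); rewrite /fdist ltr_norml /M => /andP[]; lra.
Qed.

Lemma inv_meas S : sigma_algebra setT S -> (forall U, mopen p U -> S U) ->
  forall a, S [set x | (s x)^-1 <= a].
Proof.
move=> sS h a; have hle b : S [set x | s x <= b].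
  rewrite (_ : [set _ | _] = ~` [set y | b < s y]).
    by apply/(sigmaC sS)/h/mcontinuous_open_gt.
  by apply/seteqP; split=> y /=; rewrite leNgt => /negP.
have hge b : S [set x | b <= s x].
  rewrite (_ : [set _ | _] = ~` [set y | s y < b]).
    by apply/(sigmaC sS)/h/mcontinuous_open_lt.
  by apply/seteqP; split=> y /=; rewrite leNgt => /negP.
have [a0|a0] := ltP a 0.
  rewrite (_ : [set _ | _] = set0); first exact: sigma0.
  apply/seteqP; split=> // x /= hx.
  have : 0 <= (s x)^-1 by rewrite invr_ge0.
  by lra.
(* As 0 is its own inverse, the zeros of [s] always belong to this set; for [a = 0] there is nothing
   else. *)
have -> : [set x | (s x)^-1 <= a] = [set x | s x <= 0] `|`
    (if a == 0 then set0 else [set x | a^-1 <= s x]).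
  apply/seteqP; split=> x /=.
    move=> hx; have [sx|sx] := leP (s x) 0; [by left|right].
    have aV : 0 < a by apply: lt_le_trans hx; rewrite invr_gt0.
    by rewrite gt_eqF //= -[leRHS]invrK lef_pV2 ?posrE ?invr_gt0.
  have [sx _|sx] := leP (s x) 0.
    have -> : s x = 0 by apply/eqP; rewrite eq_le sx s0.
    by rewrite invr0.
  case=> //; have [//|an] := eqVneq a 0; have aV : 0 < a by rewrite lt_def an.
  by move=> /= hx; rewrite -[leRHS]invrK lef_pV2 ?posrE ?invr_gt0.
apply: (sigmaU sS); first exact: hle.
by case: ifP => _; [exact: sigma0|exact: hge].
Qed.

End Inverse.

(** * Refinements of Polish metrics *)

Section Extension.
Variables (R : realType) (T : Type) (d : T -> T -> R).

Definition extfam (f : nat -> T -> R) n := if n is k.+1 then fdist (f k) else d.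

Lemma extfam_pmet f : pmet d -> forall n, pmet (extfam f n).
Proof. by move=> hd [|n] //=; exact: fdist_pmet. Qed.

Lemma extfam_sep f : msep d -> forall n, msep (extfam f n).
Proof. by move=> hd [|n] //=; exact: fdist_sep. Qed.

End Extension.

Section Refinement.
Variables (R : realType) (T : Type) (S : set (set T)).
Hypothesis sS : sigma_algebra setT S.
Implicit Types (d : T -> T -> R) (U A : set T).

Definition opens_in d := forall U, mopen d U -> S U.

(** Let [s] be the capped distance to the complement of [U]. Its reciprocal is 0 off [U] and at
    least 1 on [U], so making it continuous makes [U] clopen. Completeness survives because a
    bounded reciprocal keeps a sequence in [U] away from the boundary. *)
Lemma open_refine d U : polishm d -> opens_in d -> mopen d U ->
  exists d', [/\ polishm d', opens_in d', finer d' d, mopen d' U & mopen d' (~` U)].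
Proof.
move=> [hd sd cd md] Sd oU.
pose P (A : set T) := A `<=` U.
have P0 : P set0 by [].
have PS (A B : set T) : A `<=` B -> P B -> P A by move=> AB BU x /AB /BU.
pose s := srad d P; have s0 x : 0 <= s x by exact: srad_ge0.
have cs : mcontinuous d s by exact: srad_continuous.
have sd1 x y : `|s x - s y| <= d x y by exact: srad_lip.
have sU x : U x -> 0 < s x.
  move=> Ux; have [r r0 rU] := oU x Ux.
  apply: (@lt_le_trans _ _ (Num.min r 1)); first by rewrite lt_min r0 ltr01.
  apply: srad_ge => //; first by rewrite le_min (ltW r0) ler01 ge_min lexx orbT.
  by apply: PS rU; apply: mball_le; rewrite ge_min lexx.
have sC x : ~ U x -> s x = 0.
  move=> nU; apply/eqP; rewrite eq_le s0 andbT leNgt; apply/negP.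
  by move=> /(srad_gt hd P0 PS)[r r0 [_ /(_ x (mball_center x hd r0))]].
have s1 x : s x <= 1 by exact: srad_le1.
pose f x := (s x)^-1; pose p := extfam d (fun=> f); pose d' := djoin p.
have hp n : pmet (p n) by exact: extfam_pmet.
have mp : msep d' by apply: djoin_sep => n; exact: extfam_sep.
have ff : finer d' (fdist f) by exact: (djoin_finer _ 1%N).
have fU x : U x -> 1 <= f x by move=> /sU sx; rewrite /f -[leLHS]invr1 lef_pV2 ?posrE.
have fC x : ~ U x -> f x = 0 by move=> /sC; rewrite /f => ->; rewrite invr0.
exists d'; split; first split => //.
- exact: djoin_pmet.
- by apply: djoin_separated => // x y /(_ 0%N); exact: sd.
- apply: djoin_complete => // u hu.
  have [l hl] := cd u (hu 0%N).
  exists l => -[//|k]; rewrite /p /=.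
  have cf : mcauchy (fdist f) u := hu 1%N.
  have [c c0 [N hN]] := inv_cauchy_bounded s0 cf.
  have [M hM] := cf 1 ltr01.
  (* From [M] on, [f] varies by less than 1, while it jumps by at least 1 between [U] and its
     complement: the tail lies on one side. *)
  have [Us|Us] := pselect (exists2 n, (maxn N M <= n)%N & U (u n)).
    have [n nM Un] := Us; move: nM; rewrite geq_max => /andP[nN nM].
    have Uall m : (M <= m)%N -> U (u m).
      move=> mM; apply: contrapT => nU; have := hM n m nM mM.
      rewrite /fdist (fC _ nU) subr0 ltNge => /negP; apply.
      by apply: le_trans (ler_norm _); exact: fU.
    apply: (inv_lim hd cs _ hl); rewrite ltNge; apply/negP => sl.
    have c2 : 0 < c / 2 by lra.
    have [K hK] := hl _ c2.
    have h1 := hK (maxn K (maxn N M)) (leq_maxl _ _).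
    have hNM : (maxn N M <= maxn K (maxn N M))%N by rewrite leq_maxr.
    move: hNM; rewrite geq_max => /andP[/hN h2 /Uall /sU h3].
    have := sd1 (u (maxn K (maxn N M))) l.
    rewrite ler_norml => /andP[_ h4].
    by case: h2 => h2; lra.
  have Uall n : (maxn N M <= n)%N -> s (u n) = 0.
    by move=> nM; apply: sC => Un; apply: Us; exists n.
  have sl : s l = 0.
    apply/eqP; rewrite eq_le s0 andbT; apply/ler_addgt0Pr => e e0; rewrite add0r.
    have [K hK] := hl _ e0.
    have h1 := hK _ (leq_maxl K (maxn N M)).
    have h2 := Uall _ (leq_maxr K (maxn N M)).
    have := sd1 (u (maxn K (maxn N M))) l.
    by rewrite h2 ler_norml => /andP[h3 _]; lra.
  move=> e e0; exists (maxn N M) => n /Uall sn.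
  by rewrite /fdist /f sn sl subrr normr0.
- move=> V; apply: (djoin_meas hp sS _ mp) => -[|n]; first exact: (pmet_meas hd).
  by apply: (fdist_meas sS) => b; exact: (inv_meas s0 cs).
- exact: (djoin_finer _ 0%N).
- apply: finer_open ff _ => x Ux; exists 1 => // y; rewrite /mball /= => xy.
  apply: contrapT => nU; move: xy; rewrite /fdist (fC _ nU) subr0 ltNge => /negP; apply.
  by apply: le_trans (ler_norm _); exact: fU.
- apply: finer_open ff _ => x Ux; exists 1 => // y; rewrite /mball /= => xy Uy.
  move: xy; rewrite /fdist (fC _ Ux) sub0r normrN ltNge => /negP; apply.
  by apply: le_trans (ler_norm _); exact: fU.
Qed.

(* A sequence that is Cauchy for all the [d n] has a [d n]-limit for each [n];
   these limits coincide because they are also limits for the coarser [d0]. *)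
Lemma polish_join d0 (d : nat -> T -> T -> R) : pmet d0 -> separated d0 ->
  (forall n, [/\ polishm (d n), opens_in (d n) & finer (d n) d0]) ->
  polishm (djoin d) /\ opens_in (djoin d).
Proof.
move=> h0 s0 hd; have hp n : pmet (d n) by case: (hd n) => -[].
have mj : msep (djoin d) by apply: djoin_sep => n; case: (hd n) => -[].
split; last first.
  move=> U; apply: (djoin_meas hp sS _ mj) => n; apply: (pmet_meas (hp n) sS).
  by case: (hd n).
split => //; first exact: djoin_pmet.
  apply: djoin_separated => // x y /(_ 0%N).
  by case: (hd 0%N) => -[_ h _ _] _ _; exact: h.
apply: djoin_complete => // u hu.
have /choice[l hl] : forall n, exists l, mlim (d n) u l.
  by move=> n; case: (hd n) => -[_ _ h _] _ _; exact: h.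
have l0 n : mlim d0 u (l n).
  by case: (hd n) => _ _ h; apply: finer_lim h (hl n).
by exists (l 0%N) => n; rewrite (mlim_unique h0 s0 (l0 0%N) (l0 n)).
Qed.

(** The sets that can be made clopen form a sigma-algebra. A countable union of such sets is only
    open in the join of their refinements; one more use of [open_refine] makes it clopen. *)
Lemma borel_refine d A : polishm d -> opens_in d -> <<s mopen d >> A ->
  exists d', [/\ polishm d', opens_in d', finer d' d, mopen d' A & mopen d' (~` A)].
Proof.
move=> hd Sd; move: A; apply: smallest_sub; last first.
  by move=> U oU; exact: open_refine.
split.
- exists d; split => //; first exact: finer_refl.
  by move=> x _; exists 1 => // y _ [].
- move=> A [d' [h1 h2 h3 h4 h5]]; exists d'; rewrite setTD.
  by split => //; rewrite setCK.
move=> A /choice[d' hd'].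
have [h0 s0] : pmet d /\ separated d by case: hd.
have [pj oj] : polishm (djoin d') /\ opens_in (djoin d').
  by apply: (polish_join h0 s0) => n; case: (hd' n).
have hp n : pmet (d' n) by case: (hd' n) => -[].
have oA : mopen (djoin d') (\bigcup_n A n).
  apply: mopen_bigcup => n; case: (hd' n) => _ _ _ h _.
  by apply: finer_open h; exact: djoin_finer.
have [d1 [h1 h2 h3 h4 h5]] := open_refine pj oj oA.
exists d1; split => //; apply: (finer_trans h3).
by apply: finer_trans (djoin_finer _ 0%N) _; case: (hd' 0%N).
Qed.

Lemma borel_refine_seq d (A : nat -> set T) : polishm d -> opens_in d ->
  (forall n, <<s mopen d >> (A n)) ->
  exists d', [/\ polishm d', opens_in d', finer d' d &
    forall n, mopen d' (A n) /\ mopen d' (~` A n)].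
Proof.
move=> hd Sd hA; have [h0 s0] : pmet d /\ separated d by case: hd.
have /choice[d' hd'] := fun n => borel_refine hd Sd (hA n).
have [pj oj] : polishm (djoin d') /\ opens_in (djoin d').
  by apply: (polish_join h0 s0) => n; case: (hd' n).
have hp n : pmet (d' n) by case: (hd' n) => -[].
exists (djoin d'); split => //.
  by apply: finer_trans (djoin_finer _ 0%N) _; case: (hd' 0%N).
move=> n; case: (hd' n) => _ _ _ h1 h2.
by split; [apply: finer_open h1|apply: finer_open h2]; exact: djoin_finer.
Qed.

End Refinement.

(* The covers play the role of a G_delta subset of the completion of [(T, e)]:
   the hypothesis says that a Cauchy sequence whose limit in the completion
   belongs to this subset converges in [T]. *)
Section Covers.
Variables (R : realType) (T : Type) (S : set (set T)) (e : T -> T -> R).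
Variable W : nat -> set (set T).
Hypotheses (he : pmet e) (se : separated e) (me : msep e).
Hypothesis oW : forall k A, W k A -> mopen e A.
Hypothesis covW : forall k x, exists2 A, W k A & A x.
Hypothesis limW : forall u, mcauchy e u ->
  (forall k, exists2 A, W k A & exists N, forall n, (N <= n)%N -> A (u n)) ->
  exists l, mlim e u l.

Lemma covers_polish : exists e', [/\ polishm e', finer e' e & finer e e'].
Proof.
pose P k (A : set T) := exists2 B, W k B & A `<=` B.
have [T0|/existsNP[x0 _]] := pselect (forall x : T, False).
  exists e; split; [split => // u; case: (T0 (u 0%N))|exact: finer_refl|exact: finer_refl].
have P0 k : P k set0 by have [A WA _] := covW k x0; exists A.
have PS k (A B : set T) : A `<=` B -> P k B -> P k A.
  by move=> AB [C WC BC]; exists C => // x /AB /BC.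
pose s k := srad e (P k).
have s0 k x : 0 <= s k x by exact: (srad_ge0 he (P0 k) (PS k)).
have cs k : mcontinuous e (s k) by exact: (srad_continuous he (P0 k) (PS k)).
have sgt k x : 0 < s k x.
  have [A WA Ax] := covW k x; have [r r0 rA] := oW WA Ax.
  apply: (@lt_le_trans _ _ (Num.min r 1)); first by rewrite lt_min r0 ltr01.
  apply: (srad_ge (P := P k)) => //.
    by rewrite le_min (ltW r0) ler01 ge_min lexx orbT.
  exists A => // y h; apply: rA; apply: mball_le h; by rewrite ge_min lexx.
(* Each [s k] is continuous and positive, so adding the reciprocals does not change the topology. A
   sequence that is Cauchy for the new metric has every [s k] bounded below, hence a tail inside one
   member of each cover. *)
pose f k x := (s k x)^-1; pose p := extfam e f.
have hp n : pmet (p n) by exact: extfam_pmet.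
exists (djoin p); split; first split.
- exact: djoin_pmet.
- by apply: djoin_separated => // x y /(_ 0%N); exact: se.
- apply: djoin_complete => // u hu.
  have cu : mcauchy e u := hu 0%N.
  have [k|l hl] := limW cu; last by exists l => -[//|k]; exact: (inv_lim he (cs k) (sgt k l)).
  have [c c0 [N hN]] := inv_cauchy_bounded (s0 k) (hu k.+1).
  have {}hN n : (N <= n)%N -> c <= s k (u n).
    by move=> /hN [h|//]; have := sgt k (u n); rewrite -/(s k) in h; rewrite h ltxx.
  have c2 : 0 < c / 2 by lra.
  have [M hM] := cu _ c2; have := hN _ (leq_maxl N M) => h.
  have h2 : c / 2 < s k (u (maxn N M)) by lra.
  have [A WA hA] := srad_ball (he) (P0 k) (PS k) h2.
  by exists A => //; exists M => n nM; apply/hA/hM => //; exact: leq_maxr.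
- by apply: djoin_sep => n; exact: extfam_sep.
- exact: (djoin_finer _ 0%N).
apply: finer_djoin => // -[|k]; first exact: finer_refl.
move=> x a a0; have [r r0 hr] := inv_near (sgt k x) a0.
by have [t t0 ht] := cs k x _ r0; exists t => // y /ht /hr.
Qed.

End Covers.

(** * Nested balls and Cantor schemes *)

Lemma nested_balls (R : realType) (T : Type) (d : T -> T -> R)
    (x : nat -> T) (r : nat -> R) : pmet d -> mcomplete d ->
  (forall n, 0 < r n) -> (forall n, r n <= eps R n) ->
  (forall n z, d (x n.+1) z <= r n.+1 -> d (x n) z <= r n) ->
  exists l, mlim d x l /\ forall n, d (x n) l <= r n.
Proof.
move=> [dxx dC dT] cd r0 re nest.
have sub m n z : (m <= n)%N -> d (x n) z <= r n -> d (x m) z <= r m.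
  elim: n => [|n IH]; first by rewrite leqn0 => /eqP->.
  by rewrite leq_eqVlt => /predU1P[->//|mn] /nest; exact: IH.
have inb m n : (m <= n)%N -> d (x m) (x n) <= r m.
  by move=> mn; apply: sub mn _; rewrite dxx ltW.
have [l hl] : exists l, mlim d x l.
  apply: cd => e e0; have e2 : 0 < e / 2 by lra.
  have [N hN] := eps_lt e2; exists N => m n Nm Nn.
  have := dT (x m) (x N) (x n); rewrite (dC (x m) (x N)).
  by have := inb _ _ Nm; have := inb _ _ Nn; have := re N; lra.
exists l; split => // n; apply/ler_addgt0Pr => e e0; have [N hN] := hl e e0.
have := hN _ (leq_maxl N n); have := inb _ _ (leq_maxr N n).
by have := dT (x n) (x (maxn N n)) l; lra.
Qed.

Section CantorScheme.
Variables (R : realType) (T : Type) (d : T -> T -> R) (Q : set T).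
Hypotheses (hd : pmet d) (sd : separated d) (cd : mcomplete d).
Hypothesis Q0 : Q !=set0.
Hypothesis Qlim : forall u l, (forall n, Q (u n)) -> mlim d u l -> Q l.
Hypothesis Qperf : forall x e, Q x -> 0 < e -> exists y, [/\ Q y, y <> x & d x y < e].

(** Injectivity alone shows that a perfect set is uncountable; the modulus of continuity is needed
    when the image has to be compact. *)
Lemma cantor_scheme : exists c : (nat -> bool) -> T,
  [/\ forall s, Q (c s), injective c &
    forall e, 0 < e -> exists n, forall s t,
      (forall i, (i < n)%N -> s i = t i) -> d (c s) (c t) < e].
Proof.
pose state := {xr : T * R | Q xr.1 /\ 0 < xr.2}.
pose ctr (a : state) := (sval a).1; pose rad (a : state) := (sval a).2.
have d0 x y : 0 <= d x y by exact: pmet_ge0.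
have [dxx dC dT] := hd.
have split1 (a : state) : exists ab : state * state,
    [/\ forall z, d (ctr ab.1) z <= rad ab.1 -> d (ctr ab.2) z <= rad ab.2 -> False,
        forall z, d (ctr ab.1) z <= rad ab.1 -> d (ctr a) z <= rad a,
        forall z, d (ctr ab.2) z <= rad ab.2 -> d (ctr a) z <= rad a,
        rad ab.1 <= rad a / 2 & rad ab.2 <= rad a / 2].
  case: a => -[x r] [/= Qx r0]; have r2 : 0 < r / 2 by lra.
  have [y [Qy yx xy]] := Qperf Qx r2.
  have dxy : 0 < d x y.
    rewrite lt_def d0 andbT; apply/eqP => h; exact/yx/esym/sd.
  (* Closed balls of radius a third of the distance are disjoint, and [d x y < r / 2] keeps both
     inside the ball of radius [r]. *)
  pose t := d x y / 3; have t0 : 0 < t by rewrite /t; lra.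
  exists (exist _ (x, t) (conj Qx t0), exist _ (y, t) (conj Qy t0)).
  rewrite /ctr /rad /=; split; rewrite /t.
  - by move=> z h1 h2; have := dT x z y; rewrite (dC z y); lra.
  - by move=> z h1; lra.
  - by move=> z h1; have := dT x y z; lra.
  - by lra.
  - by lra.
have /choice[next hnext] := split1.
pose nx (a : state) (b : bool) := if b then (next a).1 else (next a).2.
have nx_sub a b z : d (ctr (nx a b)) z <= rad (nx a b) -> d (ctr a) z <= rad a.
  by case: (hnext a) => _ h1 h2 _ _; case: b; [exact: h1|exact: h2].
have nx_rad a b : rad (nx a b) <= rad a / 2.
  by case: (hnext a) => _ _ _ h1 h2; case: b.
have nx_disj a z b b' : d (ctr (nx a b)) z <= rad (nx a b) ->
    d (ctr (nx a b')) z <= rad (nx a b') -> b = b'.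
  by case: (hnext a) => h _ _ _ _; case: b; case: b' => // h1 h2; case: (h z).
have [x0 Qx0] := Q0.
pose a0 : state := exist _ (x0, 1) (conj Qx0 ltr01).
pose st (s : nat -> bool) := fix st n := if n is m.+1 then nx (st m) (s m) else a0.
have st_eq s t n : (forall i, (i < n)%N -> s i = t i) -> st s n = st t n.
  elim: n => //= n IH h; rewrite IH => [|i ni]; last exact/h/ltnW.
  by rewrite (h n).
have radgt a : 0 < rad a by case: a => -[? ?] [].
have st_rad s n : rad (st s n) <= eps R n.
  elim: n => [|n IH] /=; first by rewrite /rad /= /eps invr1.
  apply: le_trans (nx_rad _ _) _.
  have : eps R n / 2 <= eps R n.+1.
    rewrite /eps -invfM lef_pV2 ?posrE ?mulr_gt0 ?ltr0n // -natrM ler_nat.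
    by rewrite muln2 doubleS !ltnS -addnn leq_addr.
  by lra.
have /choice[c hc] : forall s, exists l, mlim d (fun n => ctr (st s n)) l /\
    forall n, d (ctr (st s n)) l <= rad (st s n).
  by move=> s; apply: nested_balls => // n z; exact: nx_sub.
have c_in s n : d (ctr (st s n)) (c s) <= rad (st s n) by case: (hc s).
exists c; split.
- move=> s; apply: Qlim (proj1 (hc s)) => n; rewrite /ctr.
  by case: (st s n) => -[? ?] [].
- move=> s t cst; suff h n : forall i, (i < n)%N -> s i = t i.
    by apply/funext => i; exact: (h i.+1).
  elim: n => // n IH i; rewrite ltnS leq_eqVlt => /predU1P[->|]; last exact: IH.
  have := c_in s n.+1; have := c_in t n.+1; rewrite -cst /= (st_eq _ _ _ IH).
  by move=> h1 h2; exact: nx_disj h2 h1.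
move=> e e0; have e3 : 0 < e / 3 by lra.
have [N hN] := eps_lt e3; exists N => s t hst.
have := c_in s N; have := c_in t N; have := st_rad s N; rewrite -(st_eq _ _ _ hst).
by have := dT (c s) (ctr (st s N)) (c t); rewrite (dC (c s) (ctr _)); lra.
Qed.

End CantorScheme.

(** * Baire category *)

Section MetricSpace.
Variables (R : realType) (T : Type) (d : T -> T -> R).

(** A copy of [T] labelled by its pseudometric, so that each of the topologies on the same set has
    its own canonical instance. *)
Definition mspace (hd : pmet d) : Type := T.

Variable hd : pmet d.

HB.instance Definition _ := gen_eqMixin (mspace hd).
HB.instance Definition _ := gen_choiceMixin (mspace hd).

Definition mnbhs (x : mspace hd) : set (set (mspace hd)) :=
  [set A | exists2 r, 0 < r & mball d x r `<=` A].

HB.instance Definition _ := hasNbhs.Build (mspace hd) mnbhs.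

Lemma mnbhs_filter (x : mspace hd) : ProperFilter (nbhs x).
Proof.
split; first by move=> [r r0 /(_ x (mball_center x hd r0))].
split=> [|A B [r r0 rA] [s s0 sB]|A B AB [r r0 rA]].
- by exists 1.
- exists (Num.min r s); first by rewrite lt_min r0.
  by move=> y; rewrite /mball /= lt_min => /andP[/rA ? /sB].
- by exists r => // y /rA /AB.
Qed.

Lemma mnbhs_singleton (x : mspace hd) A : nbhs x A -> A x.
Proof. by move=> [r r0]; apply; exact: mball_center. Qed.

Lemma mnbhs_nbhs (x : mspace hd) A : nbhs x A -> nbhs x (nbhs^~ A).
Proof.
move=> [r r0 rA]; exists r => // y /(mball_open hd)[s s0 hs].
by exists s => // z /hs /rA.
Qed.

HB.instance Definition _ := Nbhs_isNbhsTopological.Build (mspace hd)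
  mnbhs_filter mnbhs_singleton mnbhs_nbhs.

Lemma mspace_open (U : set (mspace hd)) : open U <-> mopen d U.
Proof. by rewrite openE. Qed.

Lemma mspace_polish : polishm d -> polish R (mspace hd).
Proof.
move=> [_ sd cd md]; split; last first.
  exists (d : mspace hd -> mspace hd -> R); split.
  - by case: hd.
  - by [].
  - move=> u /cd[l hl]; exists l => A [e e0 eA]; have [N hN] := hl e e0.
    by exists N => // n /= /hN; case: hd => _ -> _ h; exact: eA.
have [B [_ hB]] := msep_base hd md.
have [T0|/existsNP[x0 _]] := pselect (forall x : T, False).
  by exists set0 => // U [x]; case: (T0 x).
have /choice[f hf] : forall n, exists x : mspace hd, B n !=set0 -> B n x.
  by move=> n; have [[x Bx]|h] := pselect (B n !=set0); [exists x|exists x0].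
exists (range f); first exact: card_image_le.
move=> U [x Ux] /mspace_open /(_ x Ux)[r r0 rU].
have [n [Bx Br]] := hB x r r0; exists (f n); split; last by exists n.
by apply/rU/Br/hf; exists x.
Qed.

End MetricSpace.

Section PolishMetric.
Variables (R : realType) (X : topologicalType).

Lemma polish_metric : polish R X ->
  exists d : X -> X -> R, polishm d /\ forall U : set X, open U <-> mopen d U.
Proof.
move=> [[D cD dD] [d [[d0 ds dC dT] nd cd]]]; exists d.
have hd : pmet d by split.
have od (U : set X) : open U <-> mopen d U.
  by rewrite openE; split=> h x /h /nd.
split => //; split => //.
  move=> u /cd[l ul]; exists l => e e0.
  have /ul[N _ hN] : nbhs l (mball d l e) by apply/nd; exists e.
  by exists N => n /hN; rewrite /= /mball /= dC.
move=> e e0; have e2 : 0 < e / 2 by lra.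
have /choice[y hy] : forall x, exists y, D y /\ d x y < e / 2.
  move=> x; have [||y []] := dD (mball d x (e / 2)); last by exists y.
    by exists x; exact: mball_center.
  by apply/od/mball_open.
have /countable_injP[f fi] := cD.
exists (f \o y) => a b /= ab.
have yab : y a = y b by apply: fi; rewrite ?inE //; [case: (hy a)|case: (hy b)].
have [_ ha] := hy a; have [_ hb] := hy b; move: ha; rewrite yab.
by have := dT a (y b) b; rewrite (dC (y b) b); lra.
Qed.

End PolishMetric.

(** * Comeager sets and the category quantifier *)

Section Category.
Variables (R : realType) (G : topologicalType) (d : G -> G -> R).
Hypotheses (pd : polishm d) (od : forall U : set G, open U <-> mopen d U).
Implicit Types (U V A : set G).

(* [A] is comeager in [V]. *)
Definition cmg V A := exists U : nat -> set G, [/\ forall n, open (U n),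
  forall n O, open O -> O `<=` V -> O !=set0 -> O `&` U n !=set0 &
  V `&` \bigcap_n U n `<=` A].

Lemma cmg_subr V A B : A `<=` B -> cmg V A -> cmg V B.
Proof. by move=> AB [U [h1 h2 h3]]; exists U; split => // x /h3 /AB. Qed.

Lemma cmg_subl V W A : W `<=` V -> cmg V A -> cmg W A.
Proof.
move=> WV [U [h1 h2 h3]]; exists U; split => //.
  by move=> n O oO OW; apply: h2 => // x /OW /WV.
by move=> x [/WV Vx Ux]; apply: h3.
Qed.

Lemma cmg_bigcap V (A : nat -> set G) :
  (forall n, cmg V (A n)) -> cmg V (\bigcap_n A n).
Proof.
move=> /choice[U hU].
exists (fun k => if unpickle k is Some (n, m) then U n m else setT); split.
- move=> k; case: (unpickle k) => [[n m]|]; last exact: openT.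
  by case: (hU n) => h _ _.
- move=> k O oO OV O0; case: (unpickle k) => [[n m]|]; last by rewrite setIT.
  by case: (hU n) => _ h _; exact: h.
- move=> x [Vx Ux] n _; case: (hU n) => _ _; apply; split => // m _.
  by have := Ux (pickle (n, m)) I; rewrite pickleK.
Qed.

Lemma cmgI V A B : cmg V A -> cmg V B -> cmg V (A `&` B).
Proof.
move=> hA hB; have : cmg V (\bigcap_n (if n is 0%N then A else B)).
  by apply: cmg_bigcap; case.
by apply: cmg_subr => x h; split; [exact: (h 0%N I)|exact: (h 1%N I)].
Qed.

Lemma cmg_open_dense V A : open A ->
  (forall O, open O -> O `<=` V -> O !=set0 -> O `&` A !=set0) -> cmg V A.
Proof. by move=> oA h; exists (fun=> A); split => // x [_ Ax]; exact: (Ax 0%N I). Qed.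

Lemma cmg_sub V A : V `<=` A -> cmg V A.
Proof.
move=> VA; exists (fun=> setT); split; first by move=> _; exact: openT.
  by move=> _ O _ _; rewrite setIT.
by move=> x [/VA].
Qed.

Lemma baire V A : open V -> V !=set0 -> cmg V A -> V `&` A !=set0.
Proof.
move=> oV [x0 Vx0] [U [oU dU UA]].
have [hd sd cd _] := pd; have [dxx dC dT] := hd.
pose good (a : G * R) := 0 < a.2 /\ forall z, d a.1 z <= a.2 -> V z.
have step (na : nat * {a | good a}) : exists b : {a | good a},
    [/\ forall z, d (sval b).1 z <= (sval b).2 ->
          d (sval na.2).1 z <= (sval na.2).2 /\ U na.1 z
      & (sval b).2 <= (sval na.2).2 / 2].
  case: na => n [[x r] [/= r0 rV]].
  have oB : open (mball d x r) by apply/od/mball_open.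
  have [y [xy Uy]] : mball d x r `&` U n !=set0.
    apply: dU => //; first by move=> z /ltW /rV.
    by exists x; exact: mball_center.
  have [s s0 hs] : exists2 s, 0 < s & mball d y s `<=` mball d x r `&` U n.
    by have /od := openI oB (oU n); apply.
  pose t := Num.min (s / 2) (r / 2).
  have t0 : 0 < t by rewrite lt_min; apply/andP; split; lra.
  have ts : t <= s / 2 by rewrite ge_min lexx.
  have tr : t <= r / 2 by rewrite ge_min lexx orbT.
  have hz z : d y z <= t -> d x z < r /\ U n z.
    by move=> yz; apply: hs; rewrite /mball /=; lra.
  have gb : good (y, t).
    by split => //= z /hz[/ltW xz _]; exact: rV.
  by exists (exist _ _ gb); split => //= z /hz[/ltW].
have /choice[nx hnx] := step.
have [e e0 eV] : exists2 e, 0 < e & mball d x0 e `<=` V.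
  by have /od := oV; apply.
have g0 : good (x0, Num.min (e / 2) 1).
  split=> /=; first by rewrite lt_min ltr01 andbT; lra.
  by move=> z; rewrite le_min => /andP[h _]; apply: eV; rewrite /mball /=; lra.
pose st := fix st n := if n is m.+1 then nx (m, st m) else exist _ _ g0.
have [l [_ hl]] : exists l, mlim d (fun n => (sval (st n)).1) l /\
    forall n, d (sval (st n)).1 l <= (sval (st n)).2.
  apply: nested_balls => //.
  - by move=> n; case: (st n) => -[? ?] [].
  - elim=> [|n IH] /=; first by rewrite ge_min /eps invr1 lexx orbT.
    have [_ /=] := hnx (n, st n).
    have : eps R n / 2 <= eps R n.+1.
      rewrite /eps -invfM lef_pV2 ?posrE ?mulr_gt0 ?ltr0n // -natrM ler_nat.
      by rewrite muln2 doubleS !ltnS -addnn leq_addr.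
    by lra.
  - by move=> n z /=; have [h _] := hnx (n, st n) => /h[].
have Vl : V l by case: (st 0%N) (hl 0%N) => -[x r] [/= _ h] /h.
exists l; split => //; apply: UA; split => // n _.
by have [/(_ l (hl n.+1))[]] := hnx (n, st n).
Qed.

Variable Bas : nat -> set G.
Hypothesis oBas : forall n, open (Bas n).
Hypothesis hBas : forall x U, open U -> U x -> exists n, Bas n x /\ Bas n `<=` U.

(** The union of the basic sets in which [A] is comeager is dense in [V]. A dense open subset of one
    such basic set becomes dense in [V] once the exterior of that basic set is added, and
    countability of the base leaves countably many of these sets to intersect. *)
Lemma cmg_local V A :
  (forall O, open O -> O `<=` V -> O !=set0 ->
     exists W, [/\ open W, W `<=` O, W !=set0 & cmg W A]) -> cmg V A.
Proof.
move=> h.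
have /choice[U hU] : forall n, exists U : nat -> set G, cmg (Bas n) A ->
    [/\ forall m, open (U m),
     forall m O, open O -> O `<=` Bas n -> O !=set0 -> O `&` U m !=set0 &
     Bas n `&` \bigcap_m U m `<=` A].
  by move=> n; have [[U hU]|?] := pselect (cmg (Bas n) A); [exists U|exists (fun=> setT)].
pose W := \bigcup_(n in [set n | cmg (Bas n) A]) Bas n.
pose F k := if k is k'.+1 then
    (if unpickle k' is Some (n, m) then
       (if `[< cmg (Bas n) A >] then U n m `|` (~` Bas n)° else setT)
     else setT) else W.
exists F; split.
- move=> [|k] /=; first exact: bigcup_open.
  case: (unpickle k) => [[n m]|]; last exact: openT.
  case: asboolP => [/hU[oU _ _]|_]; last exact: openT.
  by apply: openU => //; exact: open_interior.
- move=> [|k] O oO OV O0 /=.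
    have [O' [oO' O'O [x O'x] cO']] := h O oO OV O0.
    have [n [Bx BO']] := hBas oO' O'x.
    exists x; split; first exact: O'O.
    by exists n => //; apply: cmg_subl cO'.
  case: (unpickle k) => [[n m]|]; last by rewrite setIT.
  case: asboolP => [/hU[_ dU _]|_]; last by rewrite setIT.
  have [OB|OB] := pselect (O `&` Bas n !=set0).
    have [|x [[Ox _] Ux]] := dU m (O `&` Bas n) (openI oO (oBas n)) _ OB.
      by move=> x [].
    by exists x; split => //; left.
  case: O0 => x Ox; exists x; split => //; right.
  rewrite /interior nbhsE; exists O; first by split.
  by move=> y Oy By; apply: OB; exists y.
- move=> x [Vx Fx]; have [n cn Bx] := Fx 0%N I.
  case: (hU n cn) => _ _; apply; split => // m _.
  have /= := Fx (pickle (n, m)).+1 I; rewrite pickleK asboolT //.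
  by case=> // /interior_subset.
Qed.

(* A local form of the Baire property. *)
Definition lbp A := forall V, open V -> V !=set0 ->
  exists W, [/\ open W, W `<=` V, W !=set0 & cmg W A \/ cmg W (~` A)].

Lemma cmg_disjoint V A : open V -> V !=set0 -> cmg V A -> cmg V (~` A) -> False.
Proof. by move=> oV V0 h1 h2; case: (baire oV V0 (cmgI h1 h2)) => x [_ []]. Qed.

Lemma lbp_open A : open A -> lbp A.
Proof.
move=> oA V oV V0; have [VA|VA] := pselect (V `&` A !=set0).
  exists (V `&` A); split => //; first exact: openI.
  by left; apply: cmg_sub => x [].
exists V; split => //; right; apply: cmg_sub => x Vx Ax; apply: VA.
by exists x.
Qed.

Lemma lbpC A : lbp A -> lbp (~` A).
Proof.
move=> h V oV V0; have [W [h1 h2 h3 h4]] := h V oV V0.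
by exists W; split => //; rewrite setCK; case: h4; [right|left].
Qed.

Lemma lbp_bigcup (A : nat -> set G) : (forall n, lbp (A n)) -> lbp (\bigcup_n A n).
Proof.
move=> h V oV V0.
have [[n [W [oW WV W0 cW]]]|hn] := pselect (exists n W,
    [/\ open W, W `<=` V, W !=set0 & cmg W (A n)]).
  by exists W; split => //; left; apply: cmg_subr cW => x Ax; exists n.
exists V; split => //; right; rewrite setC_bigcup; apply: cmg_bigcap => n.
apply: cmg_local => O oO OV O0; have [W [oW WO W0 [cW|cW]]] := h n O oO O0.
  by case: hn; exists n, W; split => // x /WO /OV.
by exists W.
Qed.

(** By the Baire property, failing to be comeager in [V] means that the complement is comeager in
    some smaller open set. Only countably many conditions remain, which is what the complement step
    of [section_cmg_borel] needs. *)
Lemma cmgE V A : open V -> lbp A ->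
  cmg V A <-> forall n, Bas n `<=` V /\ Bas n !=set0 -> ~ cmg (Bas n) (~` A).
Proof.
move=> oV bA; split.
  move=> cV n [nV n0] cn; exact: (cmg_disjoint (oBas n) n0 (cmg_subl nV cV) cn).
move=> h; apply: cmg_local => O oO OV O0.
have [W [oW WO W0 [cW|cW]]] := bA O oO O0; first by exists W.
case: W0 => x Wx; have [n [Bx BW]] := hBas oW Wx.
case: (h n); last exact: cmg_subl cW.
by split; [move=> y /BW /WO /OV|exists x].
Qed.

Variable X : topologicalType.

(** The Montgomery-Novikov theorem. The induction on [A] carries the Baire property of the sections
    along and treats all open [V] at once, since complements and unions refer to the basic subsets
    of [V]. *)
Lemma section_cmg_borel (A : set (G * X)) : borel A ->
  (forall x, lbp [set g | A (g, x)]) /\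
  forall V, open V -> borel [set x | cmg V [set g | A (g, x)]].
Proof.
have sX : sigma_algebra setT (@borel X) by exact: smallest_sigma_algebra.
move: A; apply: smallest_sub; last first.
  move=> A oA; have oAx x : open [set g | A (g, x)].
    rewrite openE => g Ag; have : nbhs (g, x) A by apply: open_nbhs_nbhs; split.
    case=> -[P Q] /= [nP nQ] PQ; apply: filterS nP => h Ph; apply: PQ; split => //=.
    exact: nbhs_singleton.
  split=> [x|V oV]; first exact: lbp_open.
  have -> : [set x | cmg V [set g | A (g, x)]] =
      [set x | forall n, Bas n `<=` V /\ Bas n !=set0 ->
         [set x | exists g, Bas n g /\ A (g, x)] x].
    apply/seteqP; split=> x /= hx.
      move=> n [nV n0]; have [g []] := baire (oBas n) n0 (cmg_subl nV hx).
      by exists g.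
    apply: cmg_open_dense => // O oO OV [g Og].
    have [n [Bg BO]] := hBas oO Og.
    have [|h [Bh Ah]] := hx n.
      by split; [move=> y /BO /OV|exists g].
    by exists h; split => //; exact: BO.
  apply: (sigma_countable_inter sX) => n; apply: sub_sigma_algebra => /=.
  rewrite openE => x [g [Bg Ag]].
  have : nbhs (g, x) A by apply: open_nbhs_nbhs; split.
  case=> -[P Q] /= [nP nQ] PQ; apply: filterS nQ => y Qy; exists g; split => //.
  by apply: PQ; split => //=; exact: nbhs_singleton.
split.
- split=> [x V oV V0|V oV].
    by exists V; split => //; right; apply: cmg_sub => g _ [].
  have [[x Vx]|V0] := pselect (V !=set0).
    rewrite (_ : [set _ | _] = set0); first exact: (sigma0 sX).
    apply/seteqP; split=> // y /= /(baire oV)[|z []] //.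
    by exists x.
  rewrite (_ : [set _ | _] = setT); first exact: (sigmaT sX).
  apply/seteqP; split=> // y _ /=; apply: cmg_sub => x Vx; case: V0.
  by exists x.
- move=> A [bA mA].
  have AC x : [set g | ([set: G * X] `\` A) (g, x)] = ~` [set g | A (g, x)].
    by apply/seteqP; split=> g //= [].
  split=> [x|V oV]; first by rewrite AC; exact: lbpC.
  rewrite (_ : [set _ | _] = [set x | forall n, Bas n `<=` V /\ Bas n !=set0 ->
      (~` [set x | cmg (Bas n) [set g | A (g, x)]]) x]).
    by apply: (sigma_countable_inter sX) => n; apply: (sigmaC sX); exact: (mA _ (oBas n)).
  apply/seteqP; split=> x /=; rewrite AC.
    by move=> /(cmgE oV (lbpC (bA x)))h n /h; rewrite setCK.
  by move=> h; apply/(cmgE oV (lbpC (bA x))) => n /h; rewrite setCK.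
move=> A hA; pose Ax n x := [set g | A n (g, x)].
have AU x : [set g | (\bigcup_n A n) (g, x)] = \bigcup_n Ax n x.
  by apply/seteqP; split=> g [n]; exists n.
split=> [x|V oV].
  by rewrite AU; apply: lbp_bigcup => n; exact: (hA n).1.
(* A union is comeager in [V] exactly when densely many basic subsets of [V] have a single member
   comeager in them. *)
rewrite (_ : [set _ | _] = [set x | forall i, Bas i `<=` V /\ Bas i !=set0 ->
    [set x | exists jn : nat * nat, (Bas jn.1 `<=` Bas i /\ Bas jn.1 !=set0) /\
      [set x | cmg (Bas jn.1) (Ax jn.2 x)] x] x]).
  apply: (sigma_countable_inter sX) => i; apply: (sigma_countable_union sX) => -[j n].
  by case: (hA n) => _ mA; exact: (mA _ (oBas j)).
apply/seteqP; split=> x /=; rewrite AU.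
  move=> hx i [iV i0]; apply: contrapT => hn.
  apply: (cmg_disjoint (oBas i) i0 (cmg_subl iV hx)).
  rewrite setC_bigcup; apply: cmg_bigcap => n; apply: cmg_local => O oO OB O0.
  have [W [oW WO [y Wy] [cW|cW]]] := (hA n).1 x O oO O0; last first.
    by exists W; split => //; exists y.
  have [j [By BW]] := hBas oW Wy; case: hn; exists (j, n) => /=; split.
    by split; [move=> z /BW /WO /OB|exists y].
  exact: cmg_subl cW.
move=> h; apply: cmg_local => O oO OV [y Oy]; have [i [By BO]] := hBas oO Oy.
have [|[j n] /= [[ji j0] cj]] := h i.
  by split; [move=> z /BO /OV|exists y].
exists (Bas j); split => //; first by move=> z /ji /BO.
by apply: cmg_subr cj => z Az; exists n.
Qed.

End Category.

(** * Left-invariant metrics *)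

Section LeftInvariantMetric.
Variables (R : realType) (G : topologicalGroupType) (d : G -> G -> R).
Hypotheses (hd : pmet d) (od : forall U : set G, open U <-> mopen d U).
Local Open Scope group_scope.

Definition wt n : R := (2 ^ n)%:R^-1.

Lemma wt_gt0 n : (0 < wt n)%R.
Proof. by rewrite invr_gt0 ltr0n expn_gt0. Qed.

Lemma wt_half n : (wt n.+1 = wt n / 2)%R.
Proof. by rewrite /wt expnS natrM invfM mulrC. Qed.

Lemma wt_lt (e : R) : (0 < e -> exists n, wt n < e)%R.
Proof.
move=> /eps_lt[n hn]; exists n; apply: le_lt_trans hn.
by rewrite /wt /eps lef_pV2 ?posrE ?ltr0n ?expn_gt0 // ler_nat ltn_expl.
Qed.

Lemma nbhs_mulg (x y : G) (U : set G) : nbhs (x * y) U ->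
  exists2 PQ : set G * set G, nbhs x PQ.1 /\ nbhs y PQ.2 &
    forall a b, PQ.1 a -> PQ.2 b -> U (a * b).
Proof.
move=> nU; have [[P Q] /= PQ h] := @mulg_continuous G (x, y) U nU.
by exists (P, Q) => // a b Pa Qb; apply: (h (a, b)).
Qed.

Lemma nbhs_mulgl (x y : G) (U : set G) : nbhs (x * y) U ->
  nbhs y [set z | U (x * z)].
Proof.
move=> /nbhs_mulg[[P Q] /= [nP nQ] h]; apply: filterS nQ => z Qz.
by apply: h => //; exact: nbhs_singleton.
Qed.

Lemma nbhs_mulgr (x y : G) (U : set G) : nbhs (x * y) U ->
  nbhs x [set z | U (z * y)].
Proof.
move=> /nbhs_mulg[[P Q] /= [nP nQ] h]; apply: filterS nP => z Pz.
by apply: h => //; exact: nbhs_singleton.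
Qed.

Lemma nbhs_invg (x : G) (U : set G) : nbhs x^-1 U -> nbhs x [set z | U z^-1].
Proof. exact: (@invg_continuous G x U). Qed.

(** Three factors are asked for because a word will be cut into an initial part, one letter and a
    final part. The ball makes the resulting chain a neighbourhood base at 1. *)
Lemma nbhs1_cube (V : set G) n : nbhs 1 V -> exists W : set G,
  [/\ nbhs 1 W, forall x, W x -> W x^-1,
    forall x y z, W x -> W y -> W z -> V (x * (y * z)) &
    W `<=` mball d 1 (eps R n)].
Proof.
move=> nV.
have sq (U : set G) : nbhs 1 U -> exists2 W : set G, nbhs 1 W &
    forall x y, W x -> W y -> U (x * y).
  rewrite -{1}(mulg1 1) => /nbhs_mulg[[P Q] /= [nP nQ] h].
  by exists (P `&` Q) => [|x y [? _] [_ ?]]; [exact: filterI|exact: h].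
have [P nP hP] := sq V nV; have [Q nQ hQ] := sq P nP.
have nB : nbhs 1 (mball d 1 (eps R n)).
  apply: open_nbhs_nbhs; split; first by apply/od/mball_open.
  by apply: mball_center => //; exact: eps_gt0.
pose W0 := P `&` Q `&` mball d 1 (eps R n).
have nW0 : nbhs 1 W0 by apply: filterI => //; exact: filterI.
exists (W0 `&` [set z | W0 z^-1]); split.
- by apply: filterI => //; apply: nbhs_invg; rewrite invg1.
- by move=> x [h1 h2]; split => //=; rewrite invgK.
- move=> x y z [[[Px _] _] _] [[[_ Qy] _] _] [[[_ Qz] _] _].
  by apply: hP => //; exact: hQ.
- by move=> x [[_ h] _].
Qed.

Lemma nbhs1_chain : exists V : nat -> set G, V 0%N = setT /\
  forall n, [/\ nbhs 1 (V n.+1), forall x, V n.+1 x -> V n.+1 x^-1,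
    forall x y z, V n.+1 x -> V n.+1 y -> V n.+1 z -> V n (x * (y * z)) &
    V n.+1 `<=` mball d 1 (eps R n)].
Proof.
have /choice[nx hnx] : forall Vn : set G * nat, exists W, nbhs 1 Vn.1 ->
   [/\ nbhs 1 W, forall x, W x -> W x^-1,
    forall x y z, W x -> W y -> W z -> Vn.1 (x * (y * z)) &
    W `<=` mball d 1 (eps R Vn.2)].
  move=> [V n]; have [nV|?] := pselect (nbhs 1 V); last by exists setT.
  by have [W hW] := nbhs1_cube n nV; exists W.
pose V := fix V n := if n is m.+1 then nx (V m, m) else setT.
exists V; split => // n; apply: (hnx (V n, n)) => /=.
by elim: n => [|n IH] /=; [exact: filterT|case: (hnx (V n, n) IH)].
Qed.

Section Words.
Variable V : nat -> set G.
Hypothesis V0 : V 0%N = setT.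
Hypothesis hV : forall n, [/\ nbhs 1 (V n.+1), forall x, V n.+1 x -> V n.+1 x^-1,
  forall x y z, V n.+1 x -> V n.+1 y -> V n.+1 z -> V n (x * (y * z)) &
  V n.+1 `<=` mball d 1 (eps R n)].

Let V1 n : V n 1.
Proof. by case: n => [|n]; rewrite ?V0 //; case: (hV n) => /nbhs_singleton. Qed.

Let VS n x : V n.+1 x -> V n x.
Proof.
by move=> Vx; case: (hV n) => _ _ /(_ x 1 1 Vx (V1 _) (V1 _)); rewrite !mulg1.
Qed.

Let Vle m n x : (m <= n)%N -> V n x -> V m x.
Proof.
elim: n => [|n IH]; first by rewrite leqn0 => /eqP->.
by rewrite leq_eqVlt => /predU1P[->//|mn] /VS; exact: IH.
Qed.

Let VV n x : V n x -> V n x^-1.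
Proof. by case: n => [|n]; rewrite ?V0 //; case: (hV n) => _ h _ _; exact: h. Qed.

Definition wprod (w : seq (nat * G)) : G := foldr (fun p y => p.2 * y) 1 w.
Definition wweight (w : seq (nat * G)) : R := foldr (fun p => +%R (wt p.1)) 0%R w.
Definition wok (w : seq (nat * G)) : Prop := foldr (fun p => and (V p.1 p.2)) True w.

Let wprod_cat w w' : wprod (w ++ w') = wprod w * wprod w'.
Proof. by elim: w => [|p w IH] /=; rewrite ?mul1g // IH mulgA. Qed.

Let wweight_cat w w' : (wweight (w ++ w') = wweight w + wweight w')%R.
Proof. by elim: w => [|p w IH] /=; rewrite ?add0r // IH addrA. Qed.

Let wok_cat w w' : wok (w ++ w') <-> wok w /\ wok w'.
Proof.
elim: w => [|p w IH] /=; first by split=> [|[]].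
by split=> [[? /IH[]]|[[? ?] ?]] //; split=> //; apply/IH.
Qed.

Let wweight_ge0 w : (0 <= wweight w)%R.
Proof. by elim: w => //= p w IH; rewrite addr_ge0 // ltW // wt_gt0. Qed.

Lemma wsplit w (t : R) : (0 <= t)%R -> (t < wweight w)%R -> exists w1 p w2,
  [/\ w = w1 ++ p :: w2, (wweight w1 <= t)%R & (t < wweight w1 + wt p.1)%R].
Proof.
elim: w t => [|p w IH] t t0 /= h; first by lra.
have [tp|tp] := ltP t (wt p.1); first by exists [::], p, w; split=> //=; lra.
have [||w1 [q [w2 [-> h1 h2]]]] := IH (t - wt p.1)%R; [lra|lra|].
by exists (p :: w1), q, w2; split => //=; lra.
Qed.

(* Split the word at half of its weight: both halves and the middle letter
   fall into [V n.+1]. *)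
Lemma wprod_small w n : wok w -> (wweight w < wt n)%R -> V n (wprod w).
Proof.
have [k] := ubnP (size w); elim: k w n => // k IH w n sw ow hw.
case: w => [|p0 w0] in sw ow hw *; first exact: V1.
set w := p0 :: w0 in sw ow hw *.
have w0' : (0 < wweight w)%R.
  by rewrite /w /=; have := wt_gt0 p0.1; have := wweight_ge0 w0; lra.
have [||w1 [p [w2 [ew h1 h2]]]] := @wsplit w (wweight w / 2)%R; [lra|lra|].
rewrite ew in sw ow hw h1 h2 *.
move: sw hw h1 h2 ow; rewrite size_cat /= addnS ltnS wweight_cat /=.
move=> sw hw h1 h2 /wok_cat[ow1 [Vp ow2]].
have h3 := wweight_ge0 w1; have h4 := wweight_ge0 w2; have h5 := wt_gt0 p.1.
rewrite wprod_cat /=; case: (hV n) => _ _ h _; apply: h.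
- apply: IH => //; last by rewrite wt_half; lra.
  exact: leq_ltn_trans (leq_addr _ _) sw.
- apply: Vle Vp; rewrite ltnNge; apply/negP => pn.
  have : (wt n <= wt p.1)%R.
    by rewrite /wt lef_pV2 ?posrE ?ltr0n ?expn_gt0 // ler_nat leq_pexp2l.
  by lra.
- apply: IH => //; last by rewrite wt_half; lra.
  exact: leq_ltn_trans (leq_addl _ _) sw.
Qed.

(** A letter from [V n] costs 2^-n. The infimum over all words forces subadditivity, and
    [V 0 = setT] ensures that every element is a one-letter word. *)
Definition gnorm (x : G) : R := inf [set r | exists w, [/\ wok w, wprod w = x & r = wweight w]].

Let wlb x : has_lbound [set r | exists w, [/\ wok w, wprod w = x & r = wweight w]].
Proof. by exists 0%R => _ [w [_ _ ->]]; exact: wweight_ge0. Qed.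

Let wne x : [set r | exists w, [/\ wok w, wprod w = x & r = wweight w]] !=set0.
Proof.
exists (wweight [:: (0%N, x)]), [:: (0%N, x)]; split => //=; last by rewrite mulg1.
by rewrite V0.
Qed.

Lemma gnorm_ge0 x : (0 <= gnorm x)%R.
Proof. by apply: lb_le_inf => // _ [w [_ _ ->]]; exact: wweight_ge0. Qed.

Lemma gnorm_le w : wok w -> (gnorm (wprod w) <= wweight w)%R.
Proof. by move=> ow; apply: ge_inf => //; exists w. Qed.

Lemma gnorm_word x (e : R) : (0 < e)%R -> exists w,
  [/\ wok w, wprod w = x & (wweight w < gnorm x + e)%R].
Proof.
move=> e0; have [|_ [w [ow xw ->]] h] := inf_adherent e0 (E :=
    [set r | exists w, [/\ wok w, wprod w = x & r = wweight w]]).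
  by split.
by exists w.
Qed.

Lemma gnorm1 : gnorm 1 = 0%R.
Proof. by apply/eqP; rewrite eq_le gnorm_ge0 andbT; exact: (@gnorm_le [::]). Qed.

Lemma gnormM x y : (gnorm (x * y)%g <= gnorm x + gnorm y)%R.
Proof.
apply/ler_addgt0Pr => e e0; have e2 : (0 < e / 2)%R by lra.
have [w [ow <- hw]] := gnorm_word x e2; have [w' [ow' <- hw']] := gnorm_word y e2.
rewrite -wprod_cat; apply: le_trans (gnorm_le _) _; first by apply/wok_cat.
by rewrite wweight_cat; lra.
Qed.

Lemma gnormV x : (gnorm x^-1%g <= gnorm x)%R.
Proof.
apply/ler_addgt0Pr => e e0; have [w [ow <- hw]] := gnorm_word x e0.
apply: le_trans (ltW hw).
suff [w' [ow' -> ->]] : exists w', [/\ wok w', (wprod w)^-1 = wprod w' &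
    wweight w = wweight w'] by exact: gnorm_le.
elim: w ow {hw} => [_|p w IH [Vp /IH[w' [ow' h1 h2]]]].
  by exists [::]; split => //=; rewrite invg1.
exists (w' ++ [:: (p.1, p.2^-1)]); split.
- by apply/wok_cat; split => //=; split => //; exact: VV.
- by rewrite wprod_cat /= invgM h1 mulg1.
- by rewrite wweight_cat /= h2 addr0 addrC.
Qed.

Lemma gnorm_small x n : (gnorm x < wt n)%R -> V n x.
Proof.
move=> h; have h0 : (0 < wt n - gnorm x)%R by lra.
by have [w [ow <- hw]] := gnorm_word x h0; apply: wprod_small => //; lra.
Qed.

Lemma gnorm_V x n : V n x -> (gnorm x <= wt n)%R.
Proof.
by move=> Vx; have := @gnorm_le [:: (n, x)]; rewrite /= mulg1 addr0; apply.
Qed.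

End Words.

(* Birkhoff-Kakutani. *)
Lemma left_invariant_metric : exists l : G -> G -> R,
  [/\ pmet l, forall g x y, l (g * x) (g * y) = l x y &
    forall U : set G, open U <-> mopen l U].
Proof.
have [V [V0 hV]] := nbhs1_chain; pose N := gnorm V.
have NV x : N x^-1 = N x.
  apply/eqP; rewrite eq_le (gnormV V0 hV) /=.
  by rewrite -{1}(invgK x) (gnormV V0 hV).
exists (fun x y => N (x^-1 * y)); split.
- split=> [x|x y|x y z].
  + by rewrite mulVg; exact: gnorm1.
  + by rewrite -NV invgM invgK.
  + have -> : x^-1 * z = (x^-1 * y) * (y^-1 * z) by rewrite mulgA mulgK.
    exact: gnormM.
- by move=> g x y; rewrite invgM mulgA mulgVK.
move=> U; split.
  rewrite openE => oU x /oU; rewrite /interior /= -{1}(mulg1 x) => /nbhs_mulgl nU.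
  have := nU; rewrite nbhsE => -[B [oB B1] BU].
  have /od/(_ 1 B1)[r r0 rB] := oB.
  have [n hn] := eps_lt r0; exists (wt n.+1); first exact: wt_gt0.
  move=> y; rewrite /mball /= => /(gnorm_small V0 hV) Vy.
  have : U (x * (x^-1 * y)); last by rewrite mulVKg.
  apply/BU/rB/(mball_le (ltW hn)).
  by case: (hV n) => _ _ _; apply.
move=> oU; rewrite openE => x /oU[r r0 rU].
have [n hn] := wt_lt r0; rewrite /interior /=.
have nV : nbhs (x^-1 * x) (V n.+1) by rewrite mulVg; case: (hV n).
apply: filterS (nbhs_mulgl nV) => y /= /gnorm_V hy.
apply: rU; rewrite /mball /=; apply: le_lt_trans hy _.
by rewrite wt_half; have := wt_gt0 n; lra.
Qed.

End LeftInvariantMetric.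

(** * The Becker-Kechris theorem *)

Lemma real_cauchy (R : realType) (w : nat -> R) :
  (forall e, 0 < e -> exists N, forall m n, (N <= m)%N -> (N <= n)%N ->
     `|w m - w n| < e) ->
  exists z, forall e, 0 < e -> exists N, forall n, (N <= n)%N -> `|w n - z| < e.
Proof.
(* The limit is the supremum of the eventual lower bounds. *)
move=> cw; pose A := [set a | exists N, forall n, (N <= n)%N -> a <= w n].
have low e : 0 < e -> exists N, A (w N - e) /\ forall n, (N <= n)%N -> `|w n - w N| < e.
  move=> /cw[N hN]; exists N; split=> [|n Nn]; last exact: hN.
  by exists N => n Nn; have := hN n N Nn (leqnn N); rewrite ltr_norml => /andP[]; lra.
have up e N : (forall n, (N <= n)%N -> `|w n - w N| < e) -> ubound A (w N + e).
  move=> hN a [M hM]; have := hM _ (leq_maxl M N); have := hN _ (leq_maxr M N).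
  by rewrite ltr_norml => /andP[]; lra.
have hA : has_sup A.
  by have [N [h1 h2]] := low 1 ltr01; split; [exists (w N - 1)|exists (w N + 1); exact: up].
exists (sup A) => e e0; have e3 : 0 < e / 3 by lra.
have [N [h1 h2]] := low _ e3; exists N => n /h2.
have : sup A <= w N + e / 3 by apply: ge_sup; [case: hA|exact: up].
have : w N - e / 3 <= sup A by apply: ub_le_sup => //; case: hA.
by rewrite !ltr_norml => ? ? /andP[? ?]; apply/andP; split; lra.
Qed.

Lemma continuous_borel (X Y : topologicalType) (f : X -> Y) :
  continuous f -> borel_map f.
Proof.
move=> cf; suff : <<s @open Y >> `<=` [set B | borel (f @^-1` B)] by [].
apply: smallest_sub; last first.
  by move=> U oU /=; apply: sub_sigma_algebra; apply: open_comp => // x _; exact: cf.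
have sX : sigma_algebra setT (@borel X) by exact: smallest_sigma_algebra.
split=> /= [|A hA|A hA].
- by rewrite preimage_set0; exact: (sigma0 sX).
- by rewrite setTD preimage_setC; exact: (sigmaC sX).
- by rewrite preimage_bigcup; exact: (sigma_bigcup sX).
Qed.

(** * Localization of a Borel set along orbits *)

Section Localization.
Variables (R : realType) (G : topologicalGroupType).
Variables (d l : G -> G -> R).
Hypotheses (pd : polishm d) (od : forall U : set G, open U <-> mopen d U).
Hypotheses (hl : pmet l) (ol : forall U : set G, open U <-> mopen l U).
Hypothesis linv : forall g x y, l (g * x)%g (g * y)%g = l x y.
Variable Bas : nat -> set G.
Hypothesis oBas : forall n, open (Bas n).
Hypothesis hBas : forall x U, open U -> U x -> exists n, Bas n x /\ Bas n `<=` U.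
Variables (X : topologicalType) (act : G -> X -> X).
Hypotheses (ha : is_action act) (ba : borel_map (fun p : G * X => act p.1 p.2)).
Implicit Types (B : set X) (V : set G).

(** The inverse turns the action on [x] into left translation of this set, which the left-invariant
    [l] does not notice. *)
Definition hits B (x : X) : set G := [set g | B (act g^-1%g x)].

(* [loc B x g] is the distance from [g] to the complement of [hits B x]
   (capped at 1), where meager sets are neglected. *)
Definition loc B x : G -> R := srad l (fun V => cmg V (hits B x)).

Let P0 B x : cmg set0 (hits B x). Proof. exact: cmg_sub. Qed.

Let PS B x (V W : set G) : V `<=` W -> cmg W (hits B x) -> cmg V (hits B x).
Proof. exact: cmg_subl. Qed.

Lemma loc_ge0 B x g : 0 <= loc B x g.
Proof. exact: (srad_ge0 hl (P0 B x) (@PS B x)). Qed.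

Lemma loc_ge B x g s : 0 <= s <= 1 -> cmg (mball l g s) (hits B x) -> s <= loc B x g.
Proof. by move=> s01 cs; apply: srad_ge. Qed.

Lemma loc_lip B x g h : `|loc B x g - loc B x h| <= l g h.
Proof. exact: (srad_lip hl (P0 B x) (@PS B x)). Qed.

Lemma loc_gt0 B x g : 0 < loc B x g -> exists2 r, 0 < r & cmg (mball l g r) (hits B x).
Proof.
by move=> /(srad_gt hl (P0 B x) (@PS B x))[r r0 [_ ?]]; exists r.
Qed.

Lemma loc_open B x V g : open V -> V g -> cmg V (hits B x) -> 0 < loc B x g.
Proof.
move=> /ol oV /oV[r r0 rV] cV.
apply: (@lt_le_trans _ _ (Num.min r 1)); first by rewrite lt_min r0 ltr01.
apply: srad_ge; first by rewrite le_min (ltW r0) ler01 ge_min lexx orbT.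
apply: cmg_subl cV => h hr; apply: rV; apply: mball_le hr.
by rewrite ge_min lexx.
Qed.

Let oball g r : open (mball l g r).
Proof. by apply/ol/mball_open. Qed.

Let actK g : cancel (act g) (act g^-1%g).
Proof. by move=> x; case: ha => h1 h2; rewrite -h2 mulVg h1. Qed.

Lemma cmg_translate h V A : cmg V A ->
  cmg [set g : G | V (h * g)%g] [set g | A (h * g)%g].
Proof.
move=> [U [oU dU UA]].
have tr k (W : set G) : open W -> open [set g : G | W (k * g)%g].
  rewrite !openE => oW g /oW; exact: nbhs_mulgl.
exists (fun n => [set g | U n (h * g)%g]); split.
- by move=> n; exact: tr.
- move=> n O oO OV [x Ox].
  have [||y [Oy Uy]] := dU n [set g | O (h^-1 * g)%g] (tr _ _ oO).
  + by move=> y /= /OV /=; rewrite mulVKg.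
  + by exists (h * x)%g; rewrite /= mulKg.
  + by exists (h^-1 * y)%g; split => //=; rewrite mulVKg.
- by move=> g [Vg Ug]; apply: UA; split => // n _; exact: (Ug n I).
Qed.

Lemma loc_act B h x g : loc B (act h x) g = loc B x (h^-1 * g)%g.
Proof.
(* Left translation by [k] carries balls at [a] to balls at [k * a] and preserves comeagerness. The
   opposite inequality is this one for the inverse of [h]. *)
have half k y a : loc B y a <= loc B (act k y) (k * a)%g.
  apply: ge_sup.
    exists 0; split; first by rewrite lexx ler01.
    apply: PS (P0 B y) => z; rewrite /mball /= => hz.
    by have := pmet_ge0 a z hl; rewrite leNgt hz.
  move=> r [r01 hr]; apply: srad_ge => //.
  have := cmg_translate k^-1%g hr.
  have -> : [set z | mball l a r (k^-1 * z)%g] = mball l (k * a)%g r.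
    by apply/seteqP; split=> z; rewrite /mball /= -(linv k a) mulVKg.
  apply: cmg_subr => z /=; rewrite /hits /=.
  by rewrite invgM invgK; case: ha => _ ->.
apply/eqP; rewrite eq_le; apply/andP; split.
  by have := half h^-1%g (act h x) g; rewrite actK.
by have := half h x (h^-1 * g)%g; rewrite mulVKg.
Qed.

Section BorelSet.
Variable B : set X.
Hypothesis mB : borel B.

Lemma hits_borel : borel [set p : G * X | hits B p.2 p.1].
Proof.
have c : continuous (fun p : G * X => (p.1^-1%g, p.2)).
  move=> [g x] W /= [[P Q] /= [nP nQ] PQ].
  exists ([set h | P h^-1%g], Q); first by split => //=; exact: nbhs_invg.
  by move=> [h y] [/= Ph Qy]; apply: PQ.
exact: (continuous_borel c (ba mB)).
Qed.

Lemma hits_lbp x : lbp (hits B x).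
Proof. by have [h _] := section_cmg_borel pd od oBas hBas hits_borel; exact: h. Qed.

Lemma hits_cmg_borel V : open V -> borel [set x | cmg V (hits B x)].
Proof. by have [_ h] := section_cmg_borel pd od oBas hBas hits_borel; exact: h. Qed.

(** Together with [loc_hits]: the open set where [loc B x] is positive differs from [hits B x] by a
    meager set. So for generic [g] the function [loc B x] decides whether the translate of [x] by
    the inverse of [g] lies in [B]. *)
Lemma hits_loc x : cmg setT [set g | hits B x g -> 0 < loc B x g].
Proof.
apply: (cmg_local oBas hBas) => O oO _ O0.
have [W [oW WO W0 [cW|cW]]] := hits_lbp x oO O0; exists W; split => //.
  by apply: cmg_sub => g Wg _; exact: loc_open cW.
by apply: cmg_subr cW => g /= nh h.
Qed.

Lemma loc_hits x : cmg setT [set g | 0 < loc B x g -> hits B x g].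
Proof.
apply: (cmg_local oBas hBas) => O oO _ O0.
have [W [oW WO W0 [cW|cW]]] := hits_lbp x oO O0; exists W; split => //.
  by apply: cmg_subr cW => g /= h.
apply: cmg_sub => g Wg /= /loc_gt0[r r0 cr]; exfalso.
apply: (@cmg_disjoint _ _ _ pd od (W `&` mball l g r) (hits B x)).
- exact: openI.
- by exists g; split => //; exact: mball_center.
- by apply: cmg_subl cr => y [].
- by apply: cmg_subl cW => y [].
Qed.

(** Comeagerness in balls is monotone in the radius, so rational radii suffice. This makes [loc]
    Borel in [x], and continuous as soon as countably many Borel sets are clopen. *)
Lemma loc_gtP a x g : a < loc B x g <-> exists s : rat,
  (a < ratr s /\ 0 <= (ratr s : R) <= 1) /\
  [set x | cmg (mball l g (ratr s)) (hits B x)] x.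
Proof.
split=> [|[s [[sa s01] cs]]]; last exact: lt_le_trans sa (loc_ge s01 cs).
move=> /(srad_gt hl (P0 B x) (@PS B x))[r ar [/andP[r0 r1] cr]].
have [a0|a0] := ltP a 0.
  exists 0%Q; rewrite rmorph0 lexx ler01; split => //=.
  by apply: cmg_subl cr; exact: mball_le.
have [s] := rat_in_itvoo ar; rewrite in_itv /= => /andP[s1 s2].
exists s; split; first by split => //; apply/andP; split; lra.
by apply: cmg_subl cr; apply: mball_le; exact: ltW.
Qed.

Lemma loc_ltP a x g : a <= 1 -> loc B x g < a <-> exists s : rat,
  (ratr s < a /\ 0 <= (ratr s : R) <= 1) /\
  (~` [set x | cmg (mball l g (ratr s)) (hits B x)]) x.
Proof.
move=> a1; split=> [h|[s [[sa s01] cs]]].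
  have [s] := rat_in_itvoo h; rewrite in_itv /= => /andP[s1 s2].
  have h0 := loc_ge0 B x g; have s01 : 0 <= (ratr s : R) <= 1 by apply/andP; split; lra.
  exists s; split => // cs; have := loc_ge s01 cs.
  by rewrite leNgt s1.
rewrite ltNge; apply/negP => h; apply: cs.
by apply: (srad_ball hl (P0 B x) (@PS B x)); exact: lt_le_trans sa h.
Qed.

Lemma loc_le_borel g a : borel [set x | loc B x g <= a].
Proof.
have sX : sigma_algebra setT (@borel X) by exact: smallest_sigma_algebra.
rewrite (_ : [set _ | _] = ~` [set x | exists s : rat,
    (a < ratr s /\ 0 <= (ratr s : R) <= 1) /\
    [set x | cmg (mball l g (ratr s)) (hits B x)] x]).
  apply: (sigmaC sX); apply: (sigma_countable_union sX) => s.
  exact: hits_cmg_borel.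
apply/seteqP; split=> x /= h; first by move=> /loc_gtP; rewrite ltNge h.
by rewrite leNgt; apply/negP => /loc_gtP.
Qed.

Lemma loc_continuous (T : X -> X -> R) g :
  (forall s : rat, let A := [set x | cmg (mball l g (ratr s)) (hits B x)] in
     mopen T A /\ mopen T (~` A)) ->
  mcontinuous T (fun x => loc B x g).
Proof.
have oU (P : rat -> Prop) (A : rat -> set X) : (forall s, mopen T (A s)) ->
    mopen T [set x | exists s, P s /\ A s x].
  move=> oA x [s [Ps /oA[r r0 rA]]]; exists r => // y /rA Ay.
  by exists s.
move=> hA; apply: open_mcontinuous => a.
  rewrite (_ : [set _ | _] = [set x | exists s : rat,
      (a < ratr s /\ 0 <= (ratr s : R) <= 1) /\
      [set x | cmg (mball l g (ratr s)) (hits B x)] x]).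
    by apply: oU => s; case: (hA s).
  by apply/seteqP; split=> x /loc_gtP.
have [a1|a1] := leP a 1; last first.
  move=> x _; exists 1 => // y _ /=; apply: le_lt_trans a1.
  exact: (srad_le1 hl (P0 B y) (@PS B y)).
rewrite (_ : [set _ | _] = [set x | exists s : rat,
    (ratr s < a /\ 0 <= (ratr s : R) <= 1) /\
    (~` [set x | cmg (mball l g (ratr s)) (hits B x)]) x]).
  by apply: oU => s; case: (hA s).
by apply/seteqP; split=> x /(loc_ltP _ _ a1).
Qed.

End BorelSet.
End Localization.

(** * The equivariant map into Lipschitz functions and its image *)

Section BeckerKechris.
Variables (R : realType) (G : topologicalGroupType).
Variables (d l : G -> G -> R).
Hypotheses (pd : polishm d) (od : forall U : set G, open U <-> mopen d U).
Hypotheses (hl : pmet l) (ol : forall U : set G, open U <-> mopen l U).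
Hypothesis linv : forall g x y, l (g * x)%g (g * y)%g = l x y.
Variable Bas : nat -> set G.
Hypothesis oBas : forall n, open (Bas n).
Hypothesis hBas : forall x U, open U -> U x -> exists n, Bas n x /\ Bas n `<=` U.
Variable gs : nat -> G.
Hypothesis hgs : forall g r, 0 < r -> exists m, l g (gs m) < r.
Variables (X : topologicalType) (act : G -> X -> X) (dX : X -> X -> R).
Hypotheses (ha : is_action act) (ba : borel_map (fun p : G * X => act p.1 p.2)).
Hypotheses (pX : polishm dX) (oX : forall U : set X, open U <-> mopen dX U).

Let sX : sigma_algebra setT (@borel X).
Proof. exact: smallest_sigma_algebra. Qed.

Notation q := (loc l act).

Let good (T : X -> X -> R) := [/\ polishm T, opens_in (@borel X) T & finer T dX].

Let good_step (T : X -> X -> R) : good T ->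
  exists T'B : (X -> X -> R) * (nat -> set X),
  [/\ good T'B.1, finer T'B.1 T, forall n, borel (T'B.2 n),
      forall x e, 0 < e -> exists n, T'B.2 n x /\ T'B.2 n `<=` mball T x e &
      forall n m, mcontinuous T'B.1 (fun x => q (T'B.2 n) x (gs m))].
Proof.
move=> [pT bT fT]; have [hT _ _ mT] := pT.
have [B [Bb hB]] := msep_base hT mT.
have bB n : borel (B n).
  case: (Bb n) => [->|[x [r ->]]]; first exact: (sigma0 sX).
  by apply: bT; exact: mball_open.
pose C n m (s : rat) := [set x | cmg (mball l (gs m) (ratr s)) (hits act (B n) x)].
pose A k := if unpickle k is Some (n, m, s) then C n m s else set0.
have bA k : <<s mopen T >> (A k).
  suff : borel (A k).
    apply: smallest_sub; first exact: smallest_sigma_algebra.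
    by move=> U /oX oU; apply: sub_sigma_algebra; exact: finer_open oU.
  rewrite /A; case: (unpickle k) => [[[n m] s]|]; last exact: (sigma0 sX).
  apply: (hits_cmg_borel pd od oBas hBas ba (bB n)).
  by apply/ol/mball_open.
have [T' [pT' bT' fT' hA]] := borel_refine_seq sX pT bT bA.
exists (T', B); split => //=; first by split => //; exact: finer_trans fT' fT.
move=> n m; apply: (loc_continuous hl) => s; have := hA (pickle (n, m, s)).
by rewrite /A pickleK.
Qed.

(** The requirement is circular: a base of [T] determines functions that [T] must make continuous.
    Each stage makes continuous the functions of a base of the preceding one, and the join of all
    stages has the union of these bases as a base. *)
Lemma compatible_base : exists (T : X -> X -> R) (B : nat -> set X),
  [/\ polishm T, forall n, borel (B n),
      forall x e, 0 < e -> exists n, B n x /\ B n `<=` mball T x e &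
      forall n m, mcontinuous T (fun x => q (B n) x (gs m))].
Proof.
have g0 : good dX.
  by split => //; [move=> U /oX; exact: sub_sigma_algebra|exact: finer_refl].
have /choice[nx hnx] : forall T : {T | good T}, exists TB : {T | good T} * (nat -> set X),
  [/\ finer (sval TB.1) (sval T), forall n, borel (TB.2 n),
      forall x e, 0 < e -> exists n, TB.2 n x /\ TB.2 n `<=` mball (sval T) x e &
      forall n m, mcontinuous (sval TB.1) (fun x => q (TB.2 n) x (gs m))].
  move=> [T gT]; have [[T' B] /= [h1 h2 h3 h4 h5]] := good_step gT.
  by exists (exist _ T' h1, B).
pose D := fix D i : {T | good T} := if i is j.+1 then (nx (D j)).1 else exist _ dX g0.
pose D' i := sval (D i); pose B i := (nx (D i)).2.
have fS i : finer (D' i.+1) (D' i) by case: (hnx (D i)).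
have fle i j : (i <= j)%N -> finer (D' j) (D' i).
  elim: j => [|j IH]; first by rewrite leqn0 => /eqP->; exact: finer_refl.
  rewrite leq_eqVlt => /predU1P[->|ij]; first exact: finer_refl.
  exact: finer_trans (fS j) (IH ij).
have hD i : good (D' i) by rewrite /D'; case: (D i).
have [hdX sdX _ _] := pX.
have [pT bT] := polish_join sX hdX sdX hD.
pose Bk k := if unpickle k is Some (i, n) then B i n else set0.
exists (djoin D'), Bk; split => //.
- move=> k; rewrite /Bk; case: (unpickle k) => [[i n]|]; last exact: (sigma0 sX).
  by case: (hnx (D i)) => _ h _ _; exact: h.
(* Up to [e / 2] the join depends only on the stages below [N], all coarser than stage [N], so a
   basic set of stage [N] fits into the ball. *)
- move=> x e e0; have e2 : 0 < e / 2 by lra.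
  have [N hN] := djoin_small D' e2.
  have [||r r0 hr] := @finer_initial _ _ D' (D' N) x (e / 2) N => //.
    by move=> n /ltnW; exact: fle.
  have [_ _ /(_ x r r0)[n [Bx Br]] _] := hnx (D N).
  exists (pickle (N, n)); rewrite /Bk pickleK; split => // y /Br /hr /hN.
  by rewrite /mball /=; lra.
- move=> k m; rewrite /Bk; case: (unpickle k) => [[i n]|]; last first.
    move=> x e e0; exists 1 => // y _.
    suff -> : q set0 x (gs m) = q set0 y (gs m) by rewrite subrr normr0.
    by rewrite /loc; congr srad.
  apply: finer_continuous (djoin_finer _ i.+1) _.
  by case: (hnx (D i)) => _ _ _ h; exact: h.
Qed.

Section Metric.
Variables (T : X -> X -> R) (B : nat -> set X).
Hypotheses (pT : polishm T) (bB : forall n, borel (B n)).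
Hypothesis hB : forall x e, 0 < e -> exists n, B n x /\ B n `<=` mball T x e.
Hypothesis cB : forall n m, mcontinuous T (fun x => q (B n) x (gs m)).

Let F k (x : X) := if unpickle k is Some (n, m) then q (B n) x (gs m) else 0.
(** The metric of pointwise convergence on [gs], pulled back along the map from [x] to its family of
    Lipschitz functions. Numbers that code no pair contribute a constant coordinate. *)
Definition emetric : X -> X -> R := djoin (fun k => fdist (F k)).
Notation e := emetric.

Let hF k : pmet (fdist (F k)). Proof. exact: fdist_pmet. Qed.

Let q_fdist n m : fdist (fun x => q (B n) x (gs m)) = fdist (F (pickle (n, m))).
Proof. by rewrite /F pickleK. Qed.

Let act1 x : act 1%g x = x. Proof. by case: ha. Qed.
Let actM g h x : act (g * h)%g x = act g (act h x). Proof. by case: ha. Qed.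

Lemma emetric_pmet : pmet e. Proof. exact: djoin_pmet. Qed.

Lemma emetric_sep : msep e. Proof. by apply: djoin_sep => k; exact: fdist_sep. Qed.

Lemma emetric_borel : opens_in (@borel X) e.
Proof.
move=> U; apply: (djoin_meas hF sX _ emetric_sep) => k.
apply: (fdist_meas sX) => a; rewrite /F; case: (unpickle k) => [[n m]|].
  exact: (loc_le_borel pd od hl ol oBas hBas ba (bB n)).
have [a0|a0] := leP 0 a.
  by rewrite (_ : [set _ | _] = setT); [exact: (sigmaT sX)|exact/seteqP].
by rewrite (_ : [set _ | _] = set0); [exact: (sigma0 sX)|apply/seteqP; split=> x //=; lra].
Qed.

Let generic (x : X) : cmg setT (\bigcap_n
  [set g | (hits act (B n) x g -> 0 < q (B n) x g) /\
           (0 < q (B n) x g -> hits act (B n) x g)]).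
Proof.
apply: cmg_bigcap => n.
have h1 := hits_loc pd od ol oBas hBas ba (bB n) x.
have h2 := loc_hits pd od hl ol oBas hBas ba (bB n) x.
exact: cmgI h1 h2.
Qed.

Let qlip n x g h : `|q (B n) x g - q (B n) x h| <= l g h.
Proof. exact: loc_lip. Qed.

(* The values at the dense set [gs] determine the 1-Lipschitz function. *)
Let q_approx n g r : 0 < r -> exists m, forall x y,
  `|q (B n) x g - q (B n) y g| <= r + fdist (fun x => q (B n) x (gs m)) x y.
Proof.
move=> r0; have r2 : 0 < r / 2 by lra.
have [m hm] := hgs g r2; exists m => x y; rewrite /fdist.
have := qlip n x g (gs m); have := qlip n y g (gs m).
have : `|q (B n) x g - q (B n) y g| <= `|q (B n) x g - q (B n) x (gs m)| +
   `|q (B n) x (gs m) - q (B n) y (gs m)| + `|q (B n) y g - q (B n) y (gs m)|.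
  rewrite (distrC (q (B n) y g)); apply: le_trans (ler_distD (q (B n) y (gs m)) _ _) _.
  by rewrite lerD2r ler_distD.
by lra.
Qed.

Let q_econt n g : mcontinuous e (fun x => q (B n) x g).
Proof.
move=> x r r0; have r2 : 0 < r / 2 by lra.
have [m hm] := q_approx n g r2.
have [s s0 hs] := djoin_uniform (fun k => fdist (F k)) (pickle (n, m)) r2.
exists s => // y /hs; rewrite -q_fdist => h.
by have := hm x y; lra.
Qed.

(** Take [g] generic for both points. Equal functions put the two translates by the inverse of [g]
    into the same basic sets of [T], so these translates coincide. *)
Lemma emetric_separated : separated e.
Proof.
apply: (djoin_separated hF) => x y hxy.
have hq n g : q (B n) x g = q (B n) y g.
  apply/eqP; rewrite -subr_eq0 -normr_eq0 eq_le normr_ge0 andbT.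
  apply/ler_addgt0Pr => r r0; have [m hm] := q_approx n g r0.
  by have := hm x y; rewrite q_fdist hxy; lra.
have [|g [_ [gx gy]]] := baire pd od openT _ (cmgI (generic x) (generic y)).
  by exists 1%g.
have [hT sT _ _] := pT.
suff : act g^-1%g x = act g^-1%g y.
  by move/(congr1 (act g)); rewrite -!actM mulgV !act1.
apply: sT; apply/eqP; rewrite eq_le pmet_ge0 // andbT.
apply/ler_addgt0Pr => r r0; rewrite add0r.
have [n [Bx Br]] := hB (act g^-1%g x) r0.
apply/ltW/Br; case: (gy n I) => _; apply; rewrite -hq.
by case: (gx n I) => + _; apply.
Qed.

(** Only finitely many coordinates matter. In each of them equivariance moves the group element into
    the argument, where the Lipschitz bound is uniform in [y]; this gives joint continuity. *)
Lemma emetric_act g x r : 0 < r -> exists2 P, nbhs g P & exists2 s, 0 < s &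
  forall h y, P h -> e x y < s -> e (act g x) (act h y) < r.
Proof.
move=> r0; have r2 : 0 < r / 2 by lra.
have [N hN] := djoin_small (fun k => fdist (F k)) r2.
suff [P nP [s s0 hs]] : exists2 P, nbhs g P & exists2 s, 0 < s &
    forall h y, P h -> e x y < s ->
    forall k, (k < N)%N -> fdist (F k) (act g x) (act h y) < r / 2.
  exists P => //; exists s => // h y Ph /(hs h y Ph)/hN; rewrite -/e; lra.
elim: N {hN} => [|N [P nP [s s0 hs]]]; first by exists setT; [exact: filterT|exists 1].
suff [Q nQ [t t0 ht]] : exists2 P, nbhs g P & exists2 s, 0 < s &
    forall h y, P h -> e x y < s -> fdist (F N) (act g x) (act h y) < r / 2.
  exists (P `&` Q); first exact: filterI.
  exists (Num.min s t); first by rewrite lt_min s0.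
  move=> h y [Ph Qh]; rewrite lt_min => /andP[/(hs h y Ph) h1 /(ht h y Qh) h2] k.
  by rewrite ltnS leq_eqVlt => /predU1P[->|/h1].
rewrite /F; case: (unpickle N) => [[n m]|]; last first.
  exists setT; [exact: filterT|exists 1 => // h y _ _].
  by rewrite /fdist subrr normr0.
have r4 : 0 < r / 4 by lra.
have [s' s0' hs'] := q_econt n (g^-1 * gs m)%g x r4.
exists [set h | mball l (g^-1 * gs m)%g (r / 4) (h^-1 * gs m)%g].
  apply: nbhs_invg (fun z => mball l (g^-1 * gs m)%g (r / 4) (z * gs m)%g) _.
  apply: (nbhs_mulgr (x := (g^-1)%g) (y := gs m) (U := mball l (g^-1 * gs m)%g (r / 4))).
  apply: open_nbhs_nbhs; split; first by apply/ol/mball_open.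
  exact: mball_center.
exists s' => // h y; rewrite /mball /= => hh /hs' hy; rewrite /fdist.
rewrite !(loc_act hl linv ha).
have := qlip n y (g^-1 * gs m)%g (h^-1 * gs m)%g.
have := ler_distD (q (B n) y (g^-1 * gs m)%g) (q (B n) x (g^-1 * gs m)%g)
  (q (B n) y (h^-1 * gs m)%g).
by lra.
Qed.

(* Near [g] the point [g^-1 x] is known to lie in the small set [B j], on which
   [q (B n) ^~ (gs i)] is nearly constant, equal to the value predicted by the
   equivariance [q (B n) (g^-1 x) (gs i) = q (B n) x (g * gs i)]. *)
Let small n i N j a := (forall x y, B j x -> B j y -> T x y <= eps R N) /\
  (forall y, B j y -> `|q (B n) y (gs i) - a| <= eps R N).

Let cell n i N g j a r : set X := [set x | r < q (B j) x g] `&`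
  ([set x | q (B n) x (g * gs i)%g < a + eps R N] `&`
   [set x | a - eps R N < q (B n) x (g * gs i)%g]).

(** The index [m] asks for a suitable [g] in every nonempty basic set, so that suitable elements are
    dense. The margin [r] keeps [q (B j) x g] positive in the limit. Openness is a separate clause
    because an empty [Bas m] imposes nothing else. *)
Let W k : set (set X) := if unpickle k is Some (m, n, i, N) then
  [set A | Bas m !=set0 -> exists g j a r, [/\ Bas m g, small n i N j a, 0 < r &
     A = cell n i N g j a r]] `&` [set A | mopen e A]
  else [set setT].

Let W_open k A : W k A -> mopen e A.
Proof.
rewrite /W; case: (unpickle k) => [[[[m n] i] N]|]; first by case.
by move=> -> x _; exists 1.
Qed.

Let cell_open n i N g j a r : mopen e (cell n i N g j a r).
Proof.
apply: mopenI; first by apply: mcontinuous_open_gt; exact: q_econt.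
apply: mopenI; first by apply: mcontinuous_open_lt; exact: q_econt.
by apply: mcontinuous_open_gt; exact: q_econt.
Qed.

Let W_cover k x : exists2 A, W k A & A x.
Proof.
rewrite /W; case: (unpickle k) => [[[[m n] i] N]|]; last by exists setT.
have [m0|m0] := pselect (Bas m !=set0); last first.
  exists setT => //; split; first by move=> /m0.
  by move=> y _; exists 1.
have [g [Bg gen]] := baire pd od (oBas m) m0 (cmg_subl (@subsetT _ _) (generic x)).
have [hT _ _ _] := pT; have [_ TC TT] := hT.
set y := act g^-1%g x; have eN := eps_gt0 R N.
have [r r0 hr] := cB n i y eN.
(* The radius [r] controls the oscillation of [q (B n)] at [gs i]; half of [eps R N] bounds the
   diameter. *)
have s0 : 0 < Num.min r (eps R N / 2) by rewrite lt_min r0; lra.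
have [j [By Bj]] := hB y s0.
have qj : 0 < q (B j) x g by case: (gen j I) => + _; apply.
exists (cell n i N g j (q (B n) y (gs i)) (q (B j) x g / 2)); last first.
  by rewrite /cell /= loc_act // invgK; split; [lra|split; lra].
split; last exact: cell_open.
move=> _; exists g, j, (q (B n) y (gs i)), (q (B j) x g / 2); split => //; last by lra.
split=> [a b /Bj + /Bj|a /Bj]; rewrite /mball /= ?lt_min.
  move=> /andP[_ h1] /andP[_ h2]; have := TT a y b; rewrite (TC a y); lra.
by move=> /andP[/hr h _]; rewrite distrC ltW.
Qed.

(** The limit function [z] is treated as if it came from a point: for one generic [g], the small
    sets [B j] with [z (j, g) > 0] behave like neighbourhoods of a point [y0], and then [act g y0]
    has the function [z]. *)
Let W_limit u : mcauchy e u ->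
  (forall k, exists2 A, W k A & exists N, forall n, (N <= n)%N -> A (u n)) ->
  exists x, mlim e u x.
Proof.
move=> cu hW; have [hT sT cT _] := pT; have [_ TC TT] := hT.
have /choice[z hz] : forall ng : nat * G, exists z, forall r, 0 < r -> exists N,
    forall k, (N <= k)%N -> `|q (B ng.1) (u k) ng.2 - z| < r.
  move=> [n g] /=; apply: real_cauchy => r r0; have r2 : 0 < r / 2 by lra.
  have [m hm] := q_approx n g r2.
  have := djoin_cauchy (pickle (n, m)) cu; rewrite -q_fdist => /(_ _ r2)[N hN].
  by exists N => a b Na Nb; have := hN a b Na Nb; have := hm (u a) (u b); lra.
have zlip n g h : `|z (n, g) - z (n, h)| <= l g h.
  apply/ler_addgt0Pr => r r0; have r2 : 0 < r / 2 by lra.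
  have [N hN] := hz (n, g) _ r2; have [M hM] := hz (n, h) _ r2.
  have := hN _ (leq_maxl N M); have := hM _ (leq_maxr N M) => /=.
  have := qlip n (u (maxn N M)) g h.
  by rewrite !ltr_norml !ler_norml => /andP[? ?] /andP[? ?] /andP[? ?]; apply/andP; split; lra.
(* The factor 2 pays for two errors: from [a] to a value at some [u k], and from there to the limit
   [z]. *)
pose D n i N := [set g | exists j a, [/\ small n i N j a, 0 < z (j, g) &
  `|z (n, g * gs i)%g - a| < 2 * eps R N]].
have oD n i N : open (D n i N).
  rewrite openE => g [j [a [sj zj za]]]; rewrite /interior /=.
  pose c := 2 * eps R N - `|z (n, g * gs i)%g - a|.
  have c0 : 0 < c by rewrite /c; lra.
  have n1 : nbhs g (mball l g (z (j, g))).
    by apply: open_nbhs_nbhs; split; [apply/ol/mball_open|exact: mball_center].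
  have n2 : nbhs g [set h | mball l (g * gs i)%g c (h * gs i)%g].
    apply: nbhs_mulgr; apply: open_nbhs_nbhs.
    by split; [apply/ol/mball_open|exact: mball_center].
  apply: filterS (filterI n1 n2) => h [h1 h2]; exists j, a; split => //.
    have := zlip j g h; move: h1; rewrite /mball /= ler_norml => h1 /andP[h3 h4]; lra.
  have := zlip n (g * gs i)%g (h * gs i)%g; move: h2; rewrite /mball /= => h2 h3.
  have := ler_distD (z (n, g * gs i)%g) (z (n, h * gs i)%g) a.
  by rewrite (distrC (z (n, (h * gs i)%g)) (z _)); rewrite /c in h2; lra.
have dD n i N O : open O -> O `<=` setT -> O !=set0 -> O `&` D n i N !=set0.
  move=> oO _ [g0 Og0]; have [m [Bg BO]] := hBas oO Og0.
  have [A + [K hK]] := hW (pickle (m, n, i, N)); rewrite /W pickleK => -[+ _].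
  case; first by exists g0.
  move=> g [j [a [r [Bg' sj r0 eA]]]]; exists g; split; first exact: BO.
  have uA k : (K <= k)%N -> cell n i N g j a r (u k) by move=> /hK; rewrite eA.
  exists j, a; split => //.
    have [M hM] := hz (j, g) _ r0.
    have [+ _] := uA _ (leq_maxl K M); have := hM _ (leq_maxr K M) => /=.
    by rewrite ltr_norml => /andP[]; lra.
  have [M hM] := hz (n, g * gs i)%g _ (eps_gt0 R N).
  have [_ [+ +]] := uA _ (leq_maxl K M); have := hM _ (leq_maxr K M) => /=.
  by rewrite !ltr_norml => /andP[h1 h2] h3 h4; apply/andP; split; lra.
have cD : cmg setT (\bigcap_k
    (if unpickle k is Some (n, i, N) then D n i N else setT)).
  apply: cmg_bigcap => k; case: (unpickle k) => [[[n i] N]|]; last exact: cmg_sub.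
  by apply: cmg_open_dense; [exact: oD|exact: dD].
have [|g [_ Dg]] := baire pd od openT _ cD; first by exists 1%g.
have /choice[ja hja] : forall niN : nat * nat * nat, exists ja : nat * R,
    [/\ small niN.1.1 niN.1.2 niN.2 ja.1 ja.2, 0 < z (ja.1, g) &
        `|z (niN.1.1, g * gs niN.1.2)%g - ja.2| < 2 * eps R niN.2].
  move=> [[n i] N]; have := Dg (pickle (n, i, N)) I.
  by rewrite pickleK => -[j [a h]]; exists (j, a).
(* Numbers that code no triple repeat the choice for (0, 0, 0), so that positivity at [g] holds for
   all [k]. *)
pose jj k := if unpickle k is Some niN then (ja niN).1 else (ja (0, 0, 0)%N).1.
have jj0 k : 0 < z (jj k, g).
  rewrite /jj; case: (unpickle k) => [niN|]; first by case: (hja niN).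
  by case: (hja (0, 0, 0)%N).
(* Finite intersection property: at a late [u M] the first [K] values at [g] are all positive, so a
   generic [h] near [g] sends [u M] by its inverse into all these sets. *)
have /choice[y hy] : forall K, exists y, forall k, (k < K)%N -> B (jj k) y.
  move=> K.
  have [M hM] : exists M, forall k, (k < K)%N -> 0 < q (B (jj k)) (u M) g.
    have /choice[N hN] : forall k, exists N, forall n, (N <= n)%N ->
        0 < q (B (jj k)) (u n) g.
      move=> k; have [N hN] := hz (jj k, g) _ (jj0 k); exists N => n /hN /=.
      by rewrite ltr_norml => /andP[]; lra.
    exists (\max_(k < K) N k) => k kK; apply: hN.
    exact: (@leq_bigmax _ (fun k : 'I_K => N k) (Ordinal kK)).
  suff [V [oV Vg cV]] : exists V, [/\ open V, V g &
      cmg V [set h | forall k, (k < K)%N -> hits act (B (jj k)) (u M) h]].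
    have [|h [_ hh]] := baire pd od oV _ cV; first by exists g.
    by exists (act h^-1%g (u M)).
  elim: K hM => [|K IH] hM.
    by exists setT; split => //; [exact: openT|exact: cmg_sub].
  have [k kK|V [oV Vg cV]] := IH; first by apply: hM; exact: ltnW.
  have [r r0 cr] := loc_gt0 hl (hM K (ltnSn K)).
  exists (V `&` mball l g r); split.
  - by apply: openI => //; apply/ol/mball_open.
  - by split => //; exact: mball_center.
  have c1 : cmg (V `&` mball l g r) (hits act (B (jj K)) (u M)).
    by apply: cmg_subl cr => h [].
  have c2 := cmg_subl (@subIsetl _ V (mball l g r)) cV.
  apply: cmg_subr (cmgI c1 c2) => h [h1 h2] k.
  by rewrite ltnS leq_eqVlt => /predU1P[->|/h2].
(* Only the diameters matter here, so the triples (0, 0, N) suffice. *)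
have [y0 hy0] : exists y0, mlim T y y0.
  apply: cT => r r0; have [N hN] := eps_lt r0.
  exists (pickle (0, 0, N)%N).+1 => a b /hy ya /hy yb.
  have [[h _] _ _] := hja (0, 0, N)%N.
  by apply: le_lt_trans hN; apply: h; [move: ya|move: yb]; rewrite /jj pickleK.
(* The bound [r] splits into r/4 from [y0] to [y M] by T-continuity, r/4 from there to the predicted
   value, and r/2 from that value to [z]. *)
have qy0 n i : q (B n) y0 (gs i) = z (n, g * gs i)%g.
  apply/eqP; rewrite -subr_eq0 -normr_eq0 eq_le normr_ge0 andbT.
  apply/ler_addgt0Pr => r r0; rewrite add0r; have r4 : 0 < r / 4 by lra.
  have [N hN] := eps_lt r4; have [[_ h1] _ /= h2] := hja (n, i, N).
  have [s s0 hs] := cB n i y0 r4; have [K hK] := hy0 s s0.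
  pose M := maxn K (pickle (n, i, N)).+1.
  have /h1 h3 : B (ja (n, i, N)).1 (y M).
    by have := hy M _ (leq_maxr _ _); rewrite /jj pickleK.
  have h4 : T y0 (y M) < s by rewrite TC; apply: hK; exact: leq_maxl.
  have := hs _ h4; move: h2 h3 => /=.
  by rewrite !ltr_norml !ler_norml => /andP[? ?] /andP[? ?] /andP[? ?]; apply/andP; split; lra.
(* By equivariance the two 1-Lipschitz functions agree at all [g * gs i], and left translation by
   [g] keeps [gs] dense. *)
have qw n h : q (B n) (act g y0) h = z (n, h).
  apply/eqP; rewrite -subr_eq0 -normr_eq0 eq_le normr_ge0 andbT.
  apply/ler_addgt0Pr => r r0; rewrite add0r; have r2 : 0 < r / 2 by lra.
  have [i hi] := hgs (g^-1 * h)%g r2.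
  have hi' : l h (g * gs i)%g < r / 2 by rewrite -(linv g^-1%g) mulKg.
  have := qlip n (act g y0) h (g * gs i)%g; have := zlip n h (g * gs i)%g.
  rewrite (loc_act hl linv ha _ _ _ (g * gs i)%g) mulKg qy0.
  by rewrite !ler_norml => /andP[? ?] /andP[? ?]; apply/andP; split; lra.
exists (act g y0); apply: djoin_lim => k; rewrite /F.
case: (unpickle k) => [[n m]|] r r0; last by exists 0%N => i _; rewrite /fdist subrr normr0.
by have [N hN] := hz (n, gs m) r r0; exists N => i /hN; rewrite /fdist qw.
Qed.

Lemma polish_equivalent : exists e', [/\ polishm e', finer e' e & finer e e'].
Proof.
exact: (covers_polish emetric_pmet emetric_separated emetric_sep W_open W_cover W_limit).
Qed.

End Metric.
End BeckerKechris.

(** * The Topological Vaught Conjecture *)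

Lemma becker_kechris (R : realType) (G : topologicalGroupType)
    (X : topologicalType) (act : G -> X -> X) :
  polish R G -> borel_Gspace R act -> exists e : X -> X -> R,
  [/\ polishm e, opens_in (@borel X) e &
    forall g x r, 0 < r -> exists2 P, nbhs g P & exists2 s, 0 < s &
      forall h y, P h -> e x y < s -> e (act g x) (act h y) < r].
Proof.
move=> /polish_metric[d [pd od]] [/polish_metric[dX [pX oX]] ha ba].
have [hd _ _ md] := pd; have [l [hl linv ol]] := left_invariant_metric hd od.
have [Bas [hBas0 hBas1]] := msep_base hd md.
have oBas n : open (Bas n).
  case: (hBas0 n) => [->|[x [r ->]]]; first exact: open0.
  by apply/od/mball_open.
have hBas x U : open U -> U x -> exists n, Bas n x /\ Bas n `<=` U.
  move=> /od oU /oU[r r0 rU]; have [n [Bx Br]] := hBas1 x r r0.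
  by exists n; split => // y /Br /rU.
have /choice[gs hgs0] : forall n, exists g, Bas n !=set0 -> Bas n g.
  move=> n; have [[g Bg]|h] := pselect (Bas n !=set0); first by exists g.
  by exists 1%g.
have hgs g r : 0 < r -> exists m, l g (gs m) < r.
  move=> r0; have [||n [Bg Br]] := hBas g (mball l g r).
  - by apply/ol/mball_open.
  - exact: mball_center.
  by exists n; apply/Br/hgs0; exists g.
have [T [B [pT bB hB cB]]] := compatible_base pd od hl ol oBas hBas gs ba pX oX.
have [e' [pe' e'e ee']] :=
  polish_equivalent pd od hl ol linv oBas hBas hgs ha ba pT bB hB cB.
exists e'; split => //.
  move=> U oU; apply: (emetric_borel pd od hl ol oBas hBas ba bB).
  exact: finer_open ee' oU.
move=> g x r r0; have [r1 r10 hr1] := ee' (act g x) r r0.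
have [P nP [s s0 hs]] := emetric_act hl ol linv hgs ha B g x r10.
have [s1 s10 hs1] := e'e x s s0; exists P => //; exists s1 => // h y Ph /hs1 hy.
exact/hr1/hs.
Qed.

Lemma no_injection_cantor (f : (nat -> bool) -> nat) : injective f -> False.
Proof.
move=> fi; have /choice[g hg] : forall n, exists t, forall s, f s = n -> t = s.
  move=> n; have [[s hs]|h] := pselect (exists s, f s = n).
    by exists s => t ht; apply: fi; rewrite hs.
  by exists (fun=> true) => s hs; case: h; exists s.
pose s n := ~~ g n n; have /(congr1 (@^~ (f s))) := hg _ s erefl.
by rewrite /s; case: (g _ _).
Qed.

Lemma uncountable_cantor (T : Type) (P : set T) (c : (nat -> bool) -> T) :
  injective c -> (forall s, P (c s)) -> ~ countable P.
Proof.
move=> ci cP /countable_injP[f fi]; apply: (@no_injection_cantor (f \o c)).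
by move=> s t /= h; apply: ci; apply: fi => //; rewrite inE.
Qed.

Lemma TVC_II_III (R : realType) (G : topologicalGroupType) :
  polish R G -> TVC_II R G -> TVC_III R G.
Proof.
move=> pG h2 X act hX; have [e [pe be ce]] := becker_kechris pG hX.
have [_ ha _] := hX; have [he se me _] := pe.
pose Y : topologicalType := mspace he.
have hY : polish_Gspace R (act : G -> Y -> Y).
  split => //; first exact: mspace_polish.
  move=> [g x] W [r r0 rW]; have [P nP [s s0 hs]] := ce g x r r0.
  exists (P, mball e x s); first by split => //=; exists s.
  by move=> [h y] [/= Ph xy]; apply/rW/hs.
have [cY|[P [[[x0 Px0] [cP lP]] iP]]] := h2 Y _ hY; first by left.
right; exists P; split => //.
  rewrite -[P]setCK; apply: (sigmaC (@smallest_sigma_algebra X setT _)).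
  by have /mspace_open := closed_openC cP; exact: be.
have [|||c [cQ ci _]] := @cantor_scheme _ _ e P he se me; last exact: uncountable_cantor ci cQ.
- by exists x0.
- move=> u x uP ux; apply: contrapT => nPx.
  have /mspace_open oPC := closed_openC cP; have [r r0 rP] := oPC x nPx.
  have [N hN] := ux r r0; apply: (rP (u N)) => //.
  by have [_ eC _] := he; rewrite /mball /= eC; exact: hN.
move=> x r Px r0; have : limit_point P x by rewrite lP.
move=> /(_ (mball e x r))[|y [/eqP yx Py xy]]; first by exists r.
by exists y.
Qed.

(** * Perfect subsets of uncountable Borel sets *)

Section BorelPerfectSet.
Variables (R : realType) (X : topologicalType).
Hypothesis pX : polish R X.

Lemma polish_hausdorff : hausdorff_space X.
Proof.
have [d [[hd sd _ _] od]] := polish_metric pX; have [_ dC dT] := hd.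
move=> x y xy; apply: sd; apply/eqP; rewrite eq_le pmet_ge0 // andbT.
apply/ler_addgt0Pr => r r0; rewrite add0r; have r2 : 0 < r / 2 by lra.
have nb z : nbhs z (mball d z (r / 2)).
  apply: open_nbhs_nbhs; split; last exact: mball_center.
  by apply/od/mball_open.
have [z [xz yz]] := xy _ _ (nb x) (nb y); move: xz yz; rewrite /mball /=.
by have := dT x z y; rewrite (dC z y); lra.
Qed.

(* Refining the topology makes [P] clopen; the condensation points of [P] in the
   finer topology carry a Cantor scheme, whose image is compact in [X]. *)
Lemma borel_perfect_set (P : set X) : borel P -> ~ countable P ->
  exists K : set X, nonempty_perfect K /\ K `<=` P.
Proof.
move=> bP uP; have [dX [pdX oX]] := polish_metric pX.
have sX : sigma_algebra setT (@borel X) by exact: smallest_sigma_algebra.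
have bX : opens_in (@borel X) dX by move=> U /oX; exact: sub_sigma_algebra.
have bP' : <<s mopen dX >> P.
  by apply: sub_sigma_algebra2 bP => U /oX.
have [d [[hd sd cd md] _ fd oP oPC]] := borel_refine sX pdX bX bP'.
have [d00 dC dT] := hd.
pose Q := [set x | P x /\ forall e, 0 < e -> ~ countable (P `&` mball d x e)].
(* A point of [P] outside [Q] lies in a basic set with countable trace on [P], and there are only
   countably many basic sets. *)
have cQ : countable (P `\` Q).
  have [B [_ hB]] := msep_base hd md.
  apply: (@sub_countable _ _ _ (\bigcup_(n in [set n | countable (P `&` B n)]) (P `&` B n))).
    apply: subset_card_le => x [Px nQ].
    have [e e0 he] : exists2 e, 0 < e & countable (P `&` mball d x e).
      apply: contrapT => h; apply: nQ; split => // e e0 ce; apply: h.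
      by exists e.
    have [n [Bx Be]] := hB x e e0; exists n => //=.
    by apply: sub_countable he; apply: subset_card_le => y [Py /Be].
  by apply: bigcup_countable => //; exact: card_le_setT.
have ncU (A : set X) : A `<=` P -> ~ countable A -> exists2 y, A y & Q y.
  move=> AP nA; apply: contrapT => h; apply: nA.
  apply: sub_countable cQ; apply: subset_card_le => y Ay; split; first exact: AP.
  by move=> Qy; apply: h; exists y.
have [|||c [cc ci cm]] := @cantor_scheme _ _ d Q hd sd cd.
- by have [y _ Qy] := ncU P (fun _ h => h) uP; exists y.
- move=> u x uQ ux; split.
    apply: contrapT => /oPC[r r0 rP]; have [N hN] := ux r r0.
    have [Pu _] := uQ N; apply: (rP (u N)) => //.
    by rewrite /mball /= dC; exact: hN.
  move=> e e0 ce; have e2 : 0 < e / 2 by lra.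
  have [N hN] := ux _ e2; have [_ /(_ _ e2)] := uQ N; apply.
  apply: sub_countable ce; apply: subset_card_le => y [Py]; rewrite /mball /= => uy.
  split => //=; have := dT x (u N) y; rewrite (dC x (u N)).
  by have := hN N (leqnn N); lra.
- move=> x e [Px hx] e0.
  (* The trace of the ball on [P] stays uncountable without [x], so it still contains a condensation
     point. *)
  have [||y [[Py xy] yx] Qy] := ncU ((P `&` mball d x e) `\` [set x]).
  + by move=> y [[]].
  + move=> h; apply: (hx e e0).
    apply: (@sub_countable _ _ _
        (\bigcup_b (if b then (P `&` mball d x e) `\` [set x] else [set x]))).
      apply: subset_card_le => y Py; have [->|yx] := pselect (y = x).
        by exists false.
      by exists true.
    by apply: bigcup_countable => // -[] _; [exact: h|exact: countable1].
  + by exists y.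
have cX : continuous (c : cantor_space -> X).
  move=> s W; rewrite nbhsE => -[U [/oX oU Us] UW].
  have [r r0 rU] := finer_open fd oU Us.
  have [n hn] := cm r r0.
  have nb : nbhs (s : cantor_space) [set t | forall i, (i < n)%N -> s i = t i].
    elim: n {hn} => [|n IH].
      by apply: filterS filterT => t _.
    have nn : nbhs (s : cantor_space) [set t : cantor_space | t n = s n].
      by have := @proj_continuous _ (fun=> bool) n s [set s n]; apply.
    apply: filterS (filterI IH nn) => t [h1 h2] i.
    by rewrite ltnS leq_eqVlt => /predU1P[->|/h1].
  apply: filterS nb => t /hn h; exact/UW/rU.
have cK : closed (range c).
  apply: (compact_closed polish_hausdorff).
  apply: (@continuous_compact cantor_space X c setT); last exact: cantor_space_compact.
  exact: continuous_subspaceT.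
exists (range c); split; last by move=> _ [s _ <-]; case: (cc s).
split; first by exists (c (fun=> true)), (fun=> true).
split => //; apply/seteqP; split=> [x lx|_ [s _ <-] U].
  apply: contrapT => nx; have [|y [_ Ky nKy]] := lx (~` range c).
    by apply: open_nbhs_nbhs; split => //; exact: closed_openC.
  exact: nKy.
rewrite nbhsE => -[V [/oX oV Vs] VU].
have [r r0 rV] := finer_open fd oV Vs.
(* Flipping digit [n] alone gives a different point of the image at distance less than [r]. *)
have [n hn] := cm r r0; pose t i := if i == n then ~~ s i else s i.
exists (c t); split; last 1 first.
- by apply/VU/rV/hn => i ni; rewrite /t ltn_eqF.
- by apply/eqP => /ci/(congr1 (@^~ n)); rewrite /t eqxx; case: (s n).
- by exists t.
Qed.

End BorelPerfectSet.

Lemma sval_inj (T : Type) (P : T -> Prop) : injective (@sval T P).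
Proof. by move=> [x Px] [y Py] /= xy; exact: eq_exist. Qed.

(** * Clopen subspaces and the return to invariant Borel sets *)

Section BorelSubspace.
Variables (R : realType) (X : topologicalType) (B : set X) (d : X -> X -> R).

Definition subdist (x y : {x | B x}) : R := d (sval x) (sval y).

(** Closedness of [B] gives completeness; its openness is used separately, in [subdist_open], to
    carry open sets back to the whole space. *)
Lemma subdist_polish : polishm d -> mopen d (~` B) -> polishm subdist.
Proof.
move=> [hd sd cd md] oBC; have [d0 dC dT] := hd; split.
- by split=> [x|x y|x y z]; [exact: d0|exact: dC|exact: dT].
- by move=> x y /sd; exact: sval_inj.
- move=> u cu; have [l hl] := cd (fun n => sval (u n)) cu.
  suff Bl : B l by exists (exist _ l Bl).
  apply: contrapT => /oBC[r r0 rB]; have [N hN] := hl r r0.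
  apply: (rB (sval (u N))); last exact: svalP.
  by rewrite /mball /= dC; exact: hN.
- by move=> e /md[c hc]; exists (c \o sval) => x y /hc.
Qed.

Lemma subdist_open U : mopen d B -> mopen subdist U ->
  mopen d [set x | exists2 b, U b & sval b = x].
Proof.
move=> oB oU _ [b Ub <-]; have [r r0 rU] := oU b Ub.
have [s s0 sB] := oB _ (svalP b).
exists (Num.min r s); first by rewrite lt_min r0.
move=> y; rewrite /mball /= lt_min => /andP[yr /sB By].
by exists (exist _ y By) => //; exact: rU.
Qed.

End BorelSubspace.

Lemma TVC_III_I (R : realType) (G : topologicalGroupType) :
  TVC_III R G -> TVC_I R G.
Proof.
move=> h3 X act [pX ha ca] B bB iB.
have [dX [pdX oX]] := polish_metric pX.
have sX : sigma_algebra setT (@borel X) by exact: smallest_sigma_algebra.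
have bX : opens_in (@borel X) dX by move=> U /oX; exact: sub_sigma_algebra.
have bB' : <<s mopen dX >> B by apply: sub_sigma_algebra2 bB => U /oX.
have [d [pd bd fd oB oBC]] := borel_refine sX pdX bX bB'.
have pS := subdist_polish pd oBC; have [hS _ _ _] := pS.
pose Y : topologicalType := mspace hS.
(* Images under the inclusion return Borel sets of the subspace to Borel sets of the original
   topology of [X], where the perfect set must be found. *)
pose lift (A : set Y) : set X := [set x | exists2 b : {x | B x}, A b & sval b = x].
have bL : forall A, borel A -> borel (lift A).
  suff : <<s @open Y >> `<=` [set A | borel (lift A)] by apply.
  apply: smallest_sub; last first.
    by move=> U /mspace_open oU /=; apply: bd; exact: subdist_open.
  split=> [|A hA|A hA] /=.
  - rewrite (_ : lift set0 = set0); first exact: (sigma0 sX).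
    by apply/seteqP; split=> x // [].
  - rewrite (_ : lift _ = B `&` ~` lift A).
      by apply: (sigmaI sX) => //; exact: (sigmaC sX).
    apply/seteqP; split=> [x [b [_ nAb] <-]|x [Bx nA]].
      split; first exact: svalP.
      by move=> [b' Ab' bb']; apply: nAb; rewrite (_ : b = b') //; exact: sval_inj.
    exists (exist _ x Bx) => //; split => // Ab; apply: nA.
    by exists (exist _ x Bx).
  - rewrite (_ : lift _ = \bigcup_n lift (A n)); first exact: (sigma_bigcup sX).
    apply/seteqP; split=> [x [b [n _ Ab] <-]|x [n _ [b Ab <-]]].
      by exists n => //; exists b.
    by exists b => //; exists n.
pose actB (g : G) (b : Y) : Y := exist _ (act g (sval b)) (iB g _ (svalP b)).
have hY : borel_Gspace R actB.
  split; first exact: mspace_polish.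
    have [a1 aM] := ha.
    by split=> [b|g h b]; apply: sval_inj => /=; rewrite ?a1 ?aM.
  move=> A bA; pose j (p : G * Y) : G * X := (p.1, sval p.2).
  have cj : continuous j.
    move=> [g b] W [[P Q] /= [nP nQ] PQ].
    exists (P, [set b' : Y | Q (sval b')]); last by move=> [h b'] [/= Ph Qb]; apply: PQ.
    split => //=; move: nQ; rewrite nbhsE => -[U [/oX oU Us] UQ].
    have [r r0 rU] := finer_open fd oU Us.
    by exists r => // b' /rU /UQ.
  have -> : (fun p => actB p.1 p.2) @^-1` A =
      j @^-1` ((fun p : G * X => act p.1 p.2) @^-1` lift A).
    apply/seteqP; split=> [[g b] /= Ab|[g b] /= [b' Ab' eb]].
      by exists (actB g b).
    by rewrite (_ : actB g b = b') //; apply: sval_inj.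
  by apply: (continuous_borel cj); apply: (continuous_borel ca); exact: bL.
have orb b : orbit_of act (sval b) = lift (orbit_of actB b).
  apply/seteqP; split=> [_ [g _ <-]|_ [_ [g _ <-] <-]].
    by exists (actB g b) => //; exists g.
  by exists g.
have [cY|[P [bP uP iP]]] := h3 Y actB hY.
  left; apply: (@sub_countable _ _ _ (lift @` orbits_in actB setT)).
    apply: subset_card_le => _ [x Bx <-].
    exists (orbit_of actB (exist _ x Bx)); first by exists (exist _ x Bx).
    by rewrite -orb.
  by apply: sub_countable cY; exact: card_image_le.
right; have [|K [pK KP]] := borel_perfect_set pX (bL _ bP).
  move=> /countable_injP[f fi]; apply: uP; apply/countable_injP.
  exists (f \o sval) => a b; rewrite !inE => Pa Pb /= ab; apply: sval_inj.
  by apply: fi ab; rewrite inE; [exists a|exists b].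
exists K; split => //; first by move=> x /KP[b _ <-]; exact: svalP.
move=> _ _ /KP[a Pa <-] /KP[b Pb <-] ab; rewrite !orb => lab.
apply: (iP a b Pa Pb); first by move=> eab; apply: ab; rewrite eab.
apply/seteqP; split=> z oz.
  have : lift (orbit_of actB b) (sval z) by rewrite -lab; exists z.
  by move=> [z' oz' /sval_inj <-].
have : lift (orbit_of actB a) (sval z) by rewrite lab; exists z.
by move=> [z' oz' /sval_inj <-].
Qed.

Lemma TVC_I_II (R : realType) (G : topologicalGroupType) : TVC_I R G -> TVC_II R G.
Proof.
move=> h1 X act hX; have [|//|cX|[P [h _ i]]] := h1 X act hX setT.
- by apply: sigmaT; exact: smallest_sigma_algebra.
- by left.
- by right; exists P.
Qed.

Theorem corollary1p3 (R : realType) (G : topologicalGroupType)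
  (hG : polish R G) :
  (TVC_I R G <-> TVC_II R G) /\ (TVC_II R G <-> TVC_III R G).
Proof.
have h12 := @TVC_I_II R G; have h23 := TVC_II_III hG; have h31 := @TVC_III_I R G.
by split; split=> h; auto.
Qed.
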